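(* Suppose that $G$ is a finite solvable group and $A$ is a finite group acting on $G$ by automorphisms. Then: (i) $\Gamma(G,A)$ is disconnected if and only if $G$ is a Frobenius group or a $2$-Frobenius group. In either case, the number of connected components of $\Gamma(G,A)$ is $m+1$, where $m$ is the number of $A$-orbits on the set of Frobenius complements of the lower Frobenius subgroup of $G$. (ii) If $\Gamma(G,A)$ is connected, then its diameter is at most $8$.
   Context: All groups are finite. Let $A$ be a finite group acting by automorphisms on the finite group $G$. The commuting graph $\Gamma(G,A)$ of this action is the simple graph whose vertex set is the set of all $A$-orbits $x^{A}$ of elements $x\in G\setminus\{1\}$, where two distinct vertices $\mathcal{O}$ and $\mathcal{O}'$ are joined by an edge if and only if there exist $x\in\mathcal{O}$ and $y\in\mathcal{O}'$ with $xy=yx$. A $2$-Frobenius group is a group $G=KLM$ with $K\trianglelefteq G$, $KL\trianglelefteq G$, such that $KL$ (with kernel $K$, complement $L$) and $LM$ (with kernel $L$, complement $M$) are both Frobenius groups. The lower Frobenius subgroup of $G$ means $G$ itself when $G=KL$ is Frobenius, and the Frobenius subgroup $KL$ when $G=KLM$ is $2$-Frobenius. *)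

(* Defs.v *)
From mathcomp Require Import all_boot all_fingroup all_solvable.
Set Implicit Arguments. Unset Strict Implicit. Unset Printing Implicit Defensive.
Local Open Scope group_scope.

Section CommutingGraph.
Variables (aT gT : finGroupType) (A : {group aT}) (G : {group gT}).
Variable to : groupAction A G.

(* vertices: the A-orbits of the nontrivial elements of G *)
Definition cg_vertices : {set {set gT}} :=
  [set orbit to A x | x in G^#].

(* edges: distinct orbits containing commuting representatives *)
Definition cg_edge : rel {set gT} := fun O O' =>
  [&& O \in cg_vertices, O' \in cg_vertices, O != O' &
      [exists x in O, exists y in O', x * y == y * x]].
End CommutingGraph.

(* Generic simple-graph notions on a vertex set V (a finite set) and a
   relation e. *)
Section GraphNotions.
Variable T : finType.
Variables (V : {set T}) (e : rel T).

(* the connected component of v *)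
Definition component (v : T) : {set T} := [set w in V | connect e v w].

(* number of connected components *)
Definition n_components : nat := #|[set component v | v in V]|.

Definition disconnected_graph : bool := 1 < n_components.

(* diameter at most n: any two vertices are joined by a path of length <= n *)
Definition diam_le (n : nat) : Prop :=
  forall u v, u \in V -> v \in V ->
    exists p : seq T, [/\ path e u p, last u p = v & size p <= n].
End GraphNotions.

Section TwoFrob.
Variable gT : finGroupType.

(* G = KLM is 2-Frobenius with K <| G, KL <| G, KL Frobenius with kernel K
   and complement L, LM Frobenius with kernel L and complement M. *)
Definition two_Frobenius_decomp (G K L M : {set gT}) : Prop :=
  [/\ K <| G, K * L <| G, [Frobenius K * L = K ><| L],
      [Frobenius L * M = L ><| M] & K * L * M = G].

Definition two_Frobenius (G : {set gT}) : Prop :=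
  exists K L M : {group gT}, two_Frobenius_decomp G K L M.

(* the set of Frobenius complements of F *)
Definition frob_complements (F : {set gT}) : {set {set gT}} :=
  [set gval H | H : {group gT} & [Frobenius F with complement H]].
End TwoFrob.

(* number of A-orbits on the Frobenius complements of F *)
Definition n_complement_orbits (aT gT : finGroupType) (A : {group aT})
  (G : {group gT}) (to : groupAction A G) (F : {set gT}) : nat :=
  #|[set orbit (to^*)%act A H | H in frob_complements F]|.

(* Main.v *)
Require Import Defs.
From mathcomp Require Import all_boot all_fingroup all_solvable.
From mathcomp Require Import ssralg vcharacter.
Set Implicit Arguments. Unset Strict Implicit. Unset Printing Implicit Defensive.
Local Open Scope group_scope.

(** Every commuting path in [G] projects to a path of orbits, so it suffices to
    treat the commuting graph of [G] itself: if the soluble group [G] is neither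
    Frobenius nor 2-Frobenius, any two nontrivial elements are at distance at
    most 8. Let [F] be the Fitting subgroup and [Z] its centre.

    If every [x] of prime order commutes with some [w <> 1] having a nontrivial
    fixed point [f] in [F], the path [v, x, w, f, z] with [z] in [Z] has length 4.
    Otherwise some [x] of prime order has a centralizer acting fixed-point-freely
    on [F]. Replacing [x] by a central element of a suitable Sylow subgroup of
    the preimage of [O_s(G / F)], one may assume [G = F N] where
    [N = N_G(<[x]>)] meets [F] trivially. The key tool is that a Frobenius
    group [D Y] acting coprimely on an abelian group on which [D] has no fixed
    points gives [Y] fixed points: hence an element of prime order in [N] which
    is fixed-point-free on [Z] centralizes [x]. This provides a common vertex
    [z] in [Z] at distance at most 4 from everything, unless
    [N] is fixed-point-free on [F] ([G] is Frobenius) or is itself a Frobenius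
    group with kernel the centralizer of [x] ([G] is 2-Frobenius).

    Conversely, in a Frobenius or 2-Frobenius group, the complements of the
    lower Frobenius subgroup and the set of elements outside all of them are
    connected and closed under commuting, so the components of the orbit graph
    are the [A]-orbits of these pieces. *)

(** * Fixed points of coprime and Frobenius actions *)

Section CoprimeAction.
Import FiniteModule GRing.Theory.
Variable gT : finGroupType.
Implicit Types B D E F G H K L P Q S U V W X Y : {group gT}.

(** Climb the derived series of [C = 'C_G('F(G))] from its trivial end. If a term lies in ['F(G)],
    the term above it centralizes it, so that larger term has nilpotency class at most 2; being
    characteristic in [G], it lies in ['F(G)] too. *)
Lemma cent_sub_Fitting G : solvable G -> 'C_G('F(G)) \subset 'F(G).
Proof.
move=> solG; pose C := ('C_G('F(G)))%G.
have solC: solvable C := solvableS (subsetIl _ _) solG.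
have nsC: C \char G by rewrite subcent_char ?char_refl ?Fitting_char.
have [n Cn] := derivedP _ solC.
suffices: forall m, m <= n -> C^`(n - m) \subset 'F(G).
  by move=> /(_ n (leqnn n)); rewrite subnn.
elim=> [|m IHm] lt_mn; first by rewrite subn0 Cn sub1G.
have charD: C^`(n - m.+1) \char G := char_trans (der_char _ _) nsC.
apply: Fitting_max; first exact: char_normal.
apply/lcnP; exists 2; apply/commG1P.
change (C^`((n - m.+1).+1) \subset 'C(C^`(n - m.+1))).
rewrite -subSn // subSS.
apply: subset_trans (IHm (ltnW lt_mn)) _; rewrite centsC.
exact: subset_trans (der_sub _ _) (subsetIr _ _).
Qed.

(** Acting by an element of [H] only permutes the summands, so the sum is a fixed point of [H]. *)
Lemma sum_actr_eq0 V (abV : abelian V) H (v : fmod_of abV) :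
  H \subset 'N(V) -> 'C_V(H) = 1 -> (\sum_(h in H) v ^@ h)%R = 0%R.
Proof.
move=> nVH cVH1; apply: val_inj; apply/set1P; rewrite -set1gE -cVH1.
rewrite inE fmodP; apply/centP=> a Ha; apply/commgP/conjg_fixP.
rewrite -fmvalJ ?(subsetP nVH) // (actr_sum a); congr (fmval _).
rewrite [RHS](reindex_inj (mulIg a)) /=.
apply: eq_big => [b | b Hb]; first by rewrite groupMr.
by rewrite actrM ?(subsetP nVH).
Qed.

Lemma sum_actr_D1 V (abV : abelian V) H (v : fmod_of abV) :
  H \subset 'N(V) -> 'C_V(H) = 1 -> (\sum_(h in H^#) v ^@ h)%R = (- v)%R.
Proof.
move=> nVH cVH1; apply/eqP; rewrite -addr_eq0; apply/eqP.
rewrite -[RHS](sum_actr_eq0 v nVH cVH1) [RHS](bigD1 1) //= actr1 addrC.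
by congr (_ + _)%R; apply: eq_bigl => h; rewrite !inE andbC.
Qed.

Lemma expg_coprime1 V v n : v \in V -> coprime #|V| n -> v ^+ n = 1 -> v = 1.
Proof.
move=> Vv coVn /eqP; rewrite -order_dvdn => dvn.
apply/eqP; rewrite -order_eq1 -dvdn1 -(eqP coVn) dvdn_gcd dvn.
by rewrite order_dvdG.
Qed.

(* If [Y] had no fixed point, the sums of [v ^ b] over [B], over [D] and over
   each of the [#|D|] conjugates of [Y] would all vanish; splitting the first one
   along the Frobenius partition of [B] then yields [v ^+ #|D| = 1]. *)
Lemma abelian_Frobenius_cent B D Y V :
    [Frobenius B = D ><| Y] -> abelian V -> B \subset 'N(V) -> V :!=: 1 ->
    coprime #|V| #|D| -> 'C_V(D) = 1 ->
  'C_V(Y) != 1.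
Proof.
move=> frobB abV nVB ntV coVD cVD1; apply: contra_neqN ntV => /eqP cVY1.
have [defB ntD ntY _ _] := Frobenius_context frobB.
have [_ mulDY nDY tiDY] := sdprodP defB.
have [sDB sYB] := mulG_sub mulDY.
have [nVD nVY] := (subset_trans sDB nVB, subset_trans sYB nVB).
have cVB1: 'C_V(B) = 1.
  by apply/trivgP; rewrite -cVD1 setIS // centS.
have partB := Frobenius_partition frobB.
apply/trivgP/subsetP=> v Vv; apply/set1P.
apply: (expg_coprime1 Vv coVD).
pose u := fmod abV v.
have sumB: (\sum_(b in B) u ^@ b = \sum_(X in gval D |: Y^# :^: D) \sum_(x in X) u ^@ x)%R.
  have [/eqP <- tiB _] := and3P partB.
  by rewrite big_trivIset.
have notD: gval D \notin Y^# :^: D.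
  apply: contraL (group1 D) => /imsetP[x _ ->].
  by rewrite conjD1g !inE eqxx.
have cardYD: #|Y^# :^: D| = #|D|.
  have [_ _ /and3P[_ _ /eqP defN]] := and3P frobB.
  rewrite card_conjugates; apply/eqP; rewrite -[X in _ == X]indexg1.
  suff ->: 'N_D(Y^#) = 1 by [].
  by apply/trivgP; rewrite -tiDY -{2}defN subsetI subsetIl setSI.
rewrite (big_setU1 _ notD) /= !sum_actr_eq0 // add0r in sumB.
rewrite (eq_bigr (fun _ => - u)%R) in sumB; last first.
  move=> _ /imsetP[x Dx ->]; rewrite conjD1g; apply: sum_actr_D1.
    by rewrite -(normsP nVD x Dx) normJ conjSg.
  by rewrite -(normsP nVD x Dx) centJ -conjIg cVY1 conjs1g.
move: sumB; rewrite sumr_const cardYD => /eqP.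
rewrite eq_sym mulNrn oppr_eq0 => /eqP/(congr1 fmval).
by rewrite fmvalZ /= fmodK.
Qed.

(* Same argument, with the partition of [E^#] by its [p + 1] lines. *)
Lemma rank2_fixpoint E V p :
    E \in 'E_p^2(E) -> abelian V -> E \subset 'N(V) -> V :!=: 1 -> coprime #|V| p ->
  exists2 e, e \in E^# & 'C_V[e] != 1.
Proof.
move=> EpE abV nVE ntV coVp.
have [_ abelE _] := pnElemP EpE; have oE := card_pnElem EpE.
have pr_p: prime p := pnElem_prime EpE.
apply/exists_inP; apply: contraR ntV; rewrite negb_exists_in => /forall_inP cV1.
have {}cV1 e : e \in E^# -> 'C_V[e] = 1.
  by move/cV1; rewrite negbK => /eqP.
apply/trivgPn; case=> v Vv /eqP[].
apply: (expg_coprime1 Vv coVp).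
pose u := fmod abV v.
pose S := [set <[e]>^# | e in E^#].
have ordE e : e \in E^# -> #[e] = p.
  by case/setD1P=> nte Ee; apply: (abelem_order_p abelE).
have cycE e x : e \in E^# -> x \in <[e]>^# -> <[x]> = <[e]>.
  move=> Ee /setD1P[ntx ex]; apply/eqP; rewrite eqEcard cycle_subG ex /=.
  have Ex: x \in E^#.
    rewrite !inE ntx (subsetP _ _ ex) // cycle_subG.
    by case/setD1P: Ee.
  by rewrite -[#|<[e]>|]/#[e] -[#|<[x]>|]/#[x] !ordE.
have partE : partition S E^#.
  apply/and3P; split; last first.
  - apply/imsetP=> [[e /setD1P[nte _]] /esym/eqP]; rewrite setD_eq0 subG1.
    by rewrite cycle_eq1 (negbTE nte).
  - apply/trivIsetP=> _ _ /imsetP[a Ea ->] /imsetP[b Eb ->].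
    apply: contraR; rewrite -setI_eq0 => /set0Pn[x /setIP[ax bx]].
    by rewrite -(cycE _ _ Ea ax) (cycE _ _ Eb bx).
  rewrite eqEsubset; apply/andP; split.
    apply/bigcupsP=> _ /imsetP[e /setD1P[_ Ee] ->]; apply: setSD.
    by rewrite cycle_subG.
  apply/subsetP=> e Ee; apply/bigcupP; exists (<[e]>^#).
    exact: imset_f.
  by have /setD1P[nte _] := Ee; rewrite !inE nte cycle_id.
have cardS : (#|S| * p.-1 = (p ^ 2).-1)%N.
  rewrite -oE [#|E|](cardsD1 1) group1 /=.
  symmetry; apply: card_uniform_partition partE.
  move=> _ /imsetP[e Ee ->]; rewrite -(ordE e Ee) orderE.
  by rewrite [#|<[e]>|](cardsD1 1) group1.
have {}cardS : #|S| = p.+1.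
  apply/eqP; rewrite -(eqn_pmul2r (_ : 0 < p.-1)); last first.
    by rewrite -subn1 subn_gt0 prime_gt1.
  rewrite cardS -mulnn -(prednK (prime_gt0 pr_p)); apply/eqP.
  by rewrite mulSn addSn /= mulnC [RHS]mulSn.
have cVE : 'C_V(E) = 1.
  have [e Ee]: exists e, e \in E^#.
    apply/set0Pn; rewrite setD_eq0 subG1 -cardG_gt1 oE.
    by rewrite (ltn_exp2l 0) ?prime_gt1.
  apply/trivgP; rewrite -(cV1 e Ee) setIS // -cent_cycle centS // cycle_subG.
  by case/setD1P: Ee.
have: (\sum_(x in E^#) u ^@ x = \sum_(X in S) \sum_(x in X) u ^@ x)%R.
  have [/eqP <- tiS _] := and3P partE.
  by rewrite big_trivIset.
rewrite (sum_actr_D1 _ nVE cVE) (eq_bigr (fun _ => - u)%R); last first.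
  move=> _ /imsetP[e Ee ->]; apply: sum_actr_D1.
    by rewrite cycle_subG (subsetP nVE) //; case/setD1P: Ee.
  by rewrite cent_cycle cV1.
(* The [p.+1] lines each contribute [- u], while the whole sum is [- u]; cancelling leaves [p]
   copies of [u] summing to zero. *)
rewrite sumr_const cardS mulrS => /eqP.
rewrite -[X in X == _]addr0 (inj_eq (addrI _)) eq_sym mulNrn oppr_eq0.
by move/eqP/(congr1 fmval); rewrite fmvalZ /= fmodK.
Qed.

End CoprimeAction.

(** Induction on [#|V|]. For abelian [V], coprimeness leaves [D] no fixed points on [[~: V, D]], so
    if this were nontrivial [X] would have one there. Otherwise [D] centralizes the derived subgroup
    of [V] and its quotient by induction, and coprime action lifts this to [V]. *)
Lemma Frobenius_fixpoint_free_cent (gT : finGroupType) (B D X V : {group gT}) :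
    [Frobenius B = D ><| X] -> B \subset 'N(V) -> solvable V ->
    coprime #|V| #|B| -> 'C_V(X) = 1 ->
  D \subset 'C(V).
Proof.
move: {2}_.+1 (ltnSn #|V|) => n; elim: n => // n IHn in gT B D X V *.
rewrite ltnS => leVn frobB nVB solV coVB cVX1.
have [defB ntD ntX _ _] := Frobenius_context frobB.
have [/andP[sDB nDB] sXB _ _ _] := sdprod_context defB.
have [nVD nVX] := (subset_trans sDB nVB, subset_trans sXB nVB).
have coVD: coprime #|V| #|D| := coprimegS sDB coVB.
have coVX: coprime #|V| #|X| := coprimegS sXB coVB.
have [abV | nabV] := boolP (abelian V).
  rewrite centsC; apply/commG1P; apply: contraTeq isT => ntW.
  have sWV: [~: V, D] \subset V by rewrite commg_subl.
  have nWB: B \subset 'N([~: V, D]) by rewrite normsR.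
  have := abelian_Frobenius_cent frobB (abelianS sWV abV) nWB ntW.
  rewrite (coprimeSg sWV) // (coprime_abel_cent_TI nVD) // => /(_ isT erefl).
  by rewrite -subG1 -cVX1 setSI.
have charU: V^`(1) \char V := der_char 1 V.
have [sUV nUV] := andP (char_normal charU).
have nUB := char_norm_trans charU nVB.
have ntU: V^`(1) != 1 by apply: contra nabV => /eqP U1; apply/commG1P.
have ntV: V :!=: 1 by apply: contra nabV => /eqP->; apply: abelian1.
have ltUV: V^`(1) \proper V := sol_der1_proper solV (subxx _) ntV.
have cUD: D \subset 'C(V^`(1)).
  apply: (IHn _ B D X) => //; first exact: leq_trans (proper_card ltUV) _.
  - exact: solvableS solV.
  - exact: coprimeSg coVB.
  by apply/trivgP; rewrite -cVX1 setSI.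
have frobBU: [Frobenius B / V^`(1) = (D / V^`(1)) ><| (X / V^`(1))].
  (* By coprimeness [B] embeds in the quotient, so its image is still a Frobenius group. *)
  have injU: 'injm (restrm nUB (coset V^`(1))).
    by rewrite ker_restrm ker_coset setIC coprime_TIg // (coprimeSg sUV).
  have := injm_Frobenius (subxx B) injU frobB.
  by rewrite !morphim_restrm setIid (setIidPr sDB) (setIidPr sXB).
have cVDU: D / V^`(1) \subset 'C(V / V^`(1)).
  apply: (IHn _ (B / V^`(1))%G _ (X / V^`(1))%G) => //.
  - exact: leq_trans (ltn_quotient ntU sUV) _.
  - exact: quotient_norms.
  - exact: quotient_sol.
  - exact: coprime_morph.
  by rewrite /= -coprime_quotient_cent ?cVX1 ?quotient1 ?(subset_trans sXB).
rewrite centsC -subsetIidl -(quotientSGK nUV) ?subsetI ?sUV 1?centsC //.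
rewrite /= (coprime_quotient_cent sUV) ?(subset_trans sDB) //.
by rewrite subsetI subxx centsC.
Qed.

Lemma exists_pcore_neq1 (gT : finGroupType) (G : {group gT}) :
  solvable G -> G :!=: 1 -> exists2 p, prime p & 'O_p(G) != 1.
Proof.
move=> solG ntG; have ntF: 'F(G) != 1 by rewrite trivg_Fitting.
have [F1 | [p pr_p p_dv_F]] := trivgVpdiv 'F(G)%G; first by rewrite F1 eqxx in ntF.
exists p => //; rewrite -p_core_Fitting.
rewrite -cardG_gt1 (card_Hall (nilpotent_pcore_Hall p (Fitting_nil G))).
by rewrite p_part_gt1 mem_primes pr_p cardG_gt0.
Qed.

(** * Fixed-point-free actions: nilpotency, ranks of Sylow subgroups, involutions *)

Section FixpointFree.
Variable gT : finGroupType.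
Implicit Types B C D E F G H K L P Q S T U V W X Y : {group gT}.

Lemma prime_semiregular V X :
  prime #|X| -> 'C_V(X) = 1 -> semiregular V X.
Proof.
move=> pr_X cVX1 x /setD1P[ntx Xx]; rewrite -cent_cycle -cVX1.
suff -> : <[x]> = X by [].
apply/eqP; rewrite eqEsubset cycle_subG Xx; apply: contraR ntx => nsXx.
by rewrite -cycle_eq1 -(prime_TIg pr_X nsXx) (setIidPr _) ?cycle_subG.
Qed.

(** If [S] is nontrivial, [S <*> X] is Frobenius and acts coprimely on the [s']-part [V] of ['F(K)],
    where [X] has no fixed points; so [S] centralizes [V]. Since [S] contains the [s]-part of
    ['F(K)], [T] is [V \x S], a nilpotent normal subgroup. *)
Lemma fixpoint_free_Sylow_sub_Fitting K X S T s :
    solvable K -> X \subset 'N(K) -> prime #|X| -> s != #|X| -> prime s ->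
    T <| K -> 'F(K) \subset T -> s.-group (T / 'F(K)) ->
    s.-Sylow(T) S -> X \subset 'N(S) -> 'C_S(X) = 1 -> 'C_('F(K))(X) = 1 ->
  T \subset 'F(K).
Proof.
move=> solK nKX pr_X s'X pr_s nsTK sFT sTF sylS nSX cSX1 cFX1.
have [sST sS _] := and3P sylS; have [sTK nTK] := andP nsTK.
have nFX: X \subset 'N('F(K)) := char_norm_trans (Fitting_char K) nKX.
have nFT: T \subset 'N('F(K)) := subset_trans sTK (normal_norm (Fitting_normal K)).
have coFX := regular_norm_coprime nFX (prime_semiregular pr_X cFX1).
have defT: 'F(K) * S = T.
  apply/eqP; rewrite eqEsubset mul_subG //= -quotientSK //.
  by rewrite (pHall_id (quotient_pHall (subset_trans sST nFT) sylS) sTF).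
have [S1 | ntS] := eqsVneq S 1; first by rewrite -defT S1 mulg1.
pose V := 'O_s^'('F(K))%G.
have charV: V \char K := char_trans (pcore_char _ _) (Fitting_char K).
have nVT: T \subset 'N(V) := subset_trans sTK (char_norm charV).
have sVF: V \subset 'F(K) := pcore_sub _ _.
have coVS: coprime #|V| #|S|.
  by rewrite coprime_sym (pnat_coprime sS (pcore_pgroup _ _)).
have coSX: coprime #|S| #|X|.
  by rewrite (pnat_coprime sS) // pnatE // !inE eq_sym.
have frob: [Frobenius S <*> X = S ><| X].
  apply/prime_FrobeniusP => //; split=> //.
  by rewrite sdprodEY // coprime_TIg.
have cVS: S \subset 'C(V).
  apply: (Frobenius_fixpoint_free_cent frob).
  - by rewrite join_subG (subset_trans sST) // (char_norm_trans charV).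
  - exact: solvableS (subset_trans sVF (Fitting_sub K)) solK.
  - have [/sdprod_card <- _ _ _ _] := Frobenius_context frob.
    by rewrite coprimeMr coVS (coprimeSg sVF).
  by apply/trivgP; rewrite -cFX1 setSI.
have nilF := Fitting_nil K.
have sFS: 'O_s('F(K)) \subset S.
  apply: subset_trans (pcore_sub_Hall sylS); apply: pcore_max (pcore_pgroup _ _) _.
  exact: char_normal_trans (pcore_char _ _) (normalS sFT sTK (Fitting_normal K)).
have defT2: V \x S = T.
  rewrite dprodE // ?coprime_TIg // -defT.
  rewrite -(dprodWC (nilpotent_pcoreC s nilF)) -mulgA [_ * S]/=.
  by rewrite (mulSGid sFS).
apply: Fitting_max => //; rewrite (dprod_nil defT2) (pgroup_nil sS) andbT.
exact: nilpotentS sVF nilF.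
Qed.

Lemma exists_pcore_preim G (N : {group gT}) p :
    N \char G ->
  exists T : {group gT}, [/\ T \char G, N \subset T & T / N = 'O_p(G / N)].
Proof.
move=> charN; have nsN := char_normal charN.
have [T defT sNT sTG] := inv_quotientN nsN (pcore_normal p (G / N)).
exists T; split=> //; apply: (char_from_quotient _ charN).
  exact: normalS (normal_sub sTG) nsN.
by rewrite -defT pcore_char.
Qed.

(** Thompson's theorem on fixed-point-free automorphisms of prime order, for soluble [K]. If [K]
    exceeded ['F(K)], the preimage [T] of some nontrivial ['O_s(K / 'F(K))] would have an
    [X]-invariant Sylow [s]-subgroup, which forces [T] into ['F(K)]. *)
Lemma prime_fixpoint_free_nil K X :
  solvable K -> X \subset 'N(K) -> prime #|X| -> 'C_K(X) = 1 -> nilpotent K.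
Proof.
move=> solK nKX pr_X cKX1.
have sFK := Fitting_sub K.
have [sKF | nsKF] := boolP (K \subset 'F(K)); first exact: nilpotentS sKF (Fitting_nil K).
have ntKF: K / 'F(K) != 1.
  by rewrite -subG1 quotient_sub1 // normal_norm ?Fitting_normal.
have [s pr_s ntO] := exists_pcore_neq1 (quotient_sol _ solK) ntKF.
have [T [charT sFT defT]] := exists_pcore_preim s (Fitting_char K).
have coKX := regular_norm_coprime nKX (prime_semiregular pr_X cKX1).
have sTK := char_sub charT.
have solX := abelian_sol (cyclic_abelian (prime_cyclic pr_X)).
have [S sylS nSX] := sol_coprime_Sylow_exists s solX
                       (char_norm_trans charT nKX) (coprimeSg sTK coKX).
have s_dv_K: s %| #|K|.
  have [sO sdv _] := pgroup_pdiv (pcore_pgroup s (K / 'F(K))) ntO.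
  exact: dvdn_trans sdv (dvdn_trans (cardSg (pcore_sub _ _)) (dvdn_morphim _ _)).
have nFT := subset_trans sTK (normal_norm (Fitting_normal K)).
case/negP: ntO; rewrite -defT -subG1 quotient_sub1 //.
apply: (fixpoint_free_Sylow_sub_Fitting solK nKX pr_X _ pr_s _ sFT _ sylS nSX).
- apply: contraTneq coKX => <-.
  by rewrite coprime_sym prime_coprime // s_dv_K.
- exact: char_normal.
- by rewrite defT pcore_pgroup.
- by apply/trivgP; rewrite -cKX1 setSI // (subset_trans (pHall_sub sylS)).
by apply/trivgP; rewrite -cKX1 setSI.
Qed.

(** The witness is the last nontrivial term of the derived series. *)
Lemma exists_char_abelian V : solvable V -> V :!=: 1 ->
  exists W : {group gT}, [/\ W \char V, W :!=: 1 & abelian W].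
Proof.
move=> solV ntV; have /ex_minnP[n /eqP Vn minV]: exists n, V^`(n) == 1.
  by have [n Vn] := derivedP _ solV; exists n; apply/eqP.
case: n => [|n] in Vn minV; first by rewrite derg0 in Vn; rewrite Vn eqxx in ntV.
exists (V^`(n))%G; split; first exact: der_char.
  by apply/negP => /minV; rewrite ltnn.
by apply/commG1P; rewrite -dergSn.
Qed.

Lemma semiregular_no_rank2 V H E p :
    V :!=: 1 -> solvable V -> H \subset 'N(V) -> semiregular V H ->
  E \in 'E_p^2(H) -> False.
Proof.
move=> ntV solV nVH regH EH.
have [W [charW ntW abW]] := exists_char_abelian solV ntV.
have [sWV nWH] := (char_sub charW, char_norm_trans charW nVH).
have [sEH abelE _] := pnElemP EH; have pr_p := pnElem_prime EH.
have coVH := regular_norm_coprime nVH regH.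
have p_dv_H: p %| #|H|.
  by rewrite (dvdn_trans _ (cardSg sEH)) // (card_pnElem EH) dvdn_exp.
have EE: E \in 'E_p^2(E) by apply/pnElemP; have [_ _ dE] := pnElemP EH.
have [|e Ee] := rank2_fixpoint EE abW (subset_trans sEH nWH) ntW.
  exact: coprimeSg sWV (coprime_dvdr p_dv_H coVH).
case/negP; rewrite -subG1 -(regH e) ?setSI //.
exact: subsetP (setSD _ sEH) e Ee.
Qed.

Lemma semiregular_p_rank V H p :
    V :!=: 1 -> solvable V -> H \subset 'N(V) -> semiregular V H -> 'r_p(H) <= 1.
Proof.
move=> ntV solV nVH regH; rewrite leqNgt; apply/negP => /p_rank_geP[E EH].
exact: semiregular_no_rank2 ntV solV nVH regH EH.
Qed.

Lemma odd_semiregular_cyclic V H P (p : nat) :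
    V :!=: 1 -> solvable V -> H \subset 'N(V) -> semiregular V H ->
  odd #|H| -> P \subset H -> p.-group P -> cyclic P.
Proof.
move=> ntV solV nVH regH oddH sPH pP.
rewrite (odd_pgroup_rank1_cyclic pP (oddSg sPH oddH)).
exact: leq_trans (p_rankS p sPH) (semiregular_p_rank p ntV solV nVH regH).
Qed.

(** It suffices that [a] centralizes every [O = 'O_s(H)]. If [a] is an [s]-element, both lie in a
    cyclic [s]-group. Otherwise a nontrivial [[~: O, <[a]>]] would be the kernel of a Frobenius
    group with complement [<[a]>], giving [a] a fixed point on [V1]. *)
Lemma odd_semiregular_prime_Fitting V H a :
    V :!=: 1 -> solvable V -> solvable H -> H \subset 'N(V) -> semiregular V H ->
  odd #|H| -> a \in H -> prime #[a] -> a \in 'F(H).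
Proof.
move=> ntV0 solV solH nVH0 regH0 oddH Ha pr_a.
have [V1 [charV ntV abV]] := exists_char_abelian solV ntV0.
have [sV1 nVH] := (char_sub charV, char_norm_trans charV nVH0).
have regH: semiregular V1 H := semiregularS sV1 (subxx _) regH0.
have saH: <[a]> \subset H by rewrite cycle_subG.
have coVH := regular_norm_coprime nVH regH.
apply: (subsetP (cent_sub_Fitting solH)); rewrite inE Ha /=.
rewrite -sub_cent1 FittingEgen gen_subG.
apply/bigcupsP => [[s /= _] _]; set O := 'O_s(H).
have nOa: <[a]> \subset 'N(O) := subset_trans saH (normal_norm (pcore_normal s H)).
have sOH: O \subset H := pcore_sub s H.
have sO: s.-group O := pcore_pgroup s H.
rewrite -cent_cycle.
have [sa | s'a] := boolP (s.-elt a).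
  have sP: s.-group (O <*> <[a]>) by rewrite norm_joinEr // pgroupM sO.
  have cycP: cyclic (O <*> <[a]>).
    apply: (odd_semiregular_cyclic ntV0 solV nVH0 regH0 oddH _ sP).
    by rewrite join_subG sOH.
  apply: subset_trans (joing_subl _ _) _.
  exact: subset_trans (cyclic_abelian cycP) (centS (joing_subr _ _)).
have cycO := odd_semiregular_cyclic ntV0 solV nVH0 regH0 oddH sOH sO.
have coOa: coprime #|O| #|<[a]>|.
  by rewrite (pnat_coprime sO) //; move: s'a; rewrite /p_elt !pnatE.
apply/commG1P; apply: contraTeq isT => ntD.
have sDO : [~: O, <[a]>] \subset O by rewrite commg_subl.
have frob: [Frobenius [~: O, <[a]>] <*> <[a]> = [~: O, <[a]>] ><| <[a]>].
  apply/prime_FrobeniusP => //; split; last first.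
    exact: coprime_abel_cent_TI nOa coOa (cyclic_abelian cycO).
  rewrite sdprodEY ?normsR ?normG // coprime_TIg // (coprimeSg sDO) //.
have sDH := subset_trans sDO sOH.
have:= abelian_Frobenius_cent frob abV _ ntV _ _.
rewrite join_subG !(subset_trans _ nVH) // (coprimegS sDH) //.
rewrite (cent_semiregular regH) // => /(_ isT isT erefl).
rewrite (cent_semiregular regH) ?eqxx // -cardG_gt1 -orderE prime_gt1 //.
Qed.

(** Both elements lie in ['F(H)], which is cyclic: it is nilpotent with cyclic Sylow subgroups. *)
Lemma odd_semiregular_prime_commute V H a b :
    V :!=: 1 -> solvable V -> solvable H -> H \subset 'N(V) -> semiregular V H ->
  odd #|H| -> a \in H -> b \in H -> prime #[a] -> prime #[b] -> commute a b.
Proof.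
move=> ntV solV solH nVH regH oddH Ha Hb pr_a pr_b.
have Fprime := odd_semiregular_prime_Fitting ntV solV solH nVH regH oddH.
have [Fa Fb] := (Fprime a Ha pr_a, Fprime b Hb pr_b).
suff cycF: cyclic 'F(H) by apply: (centsP (cyclic_abelian cycF)).
apply: nil_Zgroup_cyclic (Fitting_nil H).
apply/forall_inP => P /SylowP[p _ sylP].
apply: (odd_semiregular_cyclic ntV solV nVH regH oddH) (pHall_pgroup sylP).
exact: subset_trans (pHall_sub sylP) (Fitting_sub H).
Qed.

(** Without fixed points, [w |-> [~ w, t]] is injective on [V], hence onto; and an involution [t]
    inverts every [[~ w, t]]. *)
Lemma fixpoint_free_involution_inverts V t v :
  t \in 'N(V) -> #[t] = 2 -> 'C_V[t] = 1 -> v \in V -> v ^ t = v^-1.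
Proof.
move=> nVt ot cVt1 Vv.
have injf: {in V &, injective (fun w => [~ w, t])}.
  move=> x y Vx Vy /= eq_xy; apply/eqP; rewrite eq_mulgV1; apply/eqP/set1P.
  rewrite -set1gE -cVt1 inE groupM ?groupV //; apply/cent1P/commgP/conjg_fixP.
  rewrite conjMg conjVg; move/eqP: eq_xy; rewrite !commgEl => eq_xy.
  have {}eq_xy : x ^ t = x * y^-1 * y ^ t.
    by apply/eqP; rewrite -mulgA -(inj_eq (mulgI x^-1)) mulKg.
  by rewrite eq_xy mulgK.
have [w Vw ->]: exists2 w, w \in V & v = [~ w, t].
  have sfV: [set [~ w, t] | w in V] \subset V.
    by apply/subsetP=> _ /imsetP[w Vw ->]; rewrite groupMl ?groupV // memJ_norm.
  have /eqP defV: [set [~ w, t] | w in V] == V.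
    by rewrite eqEcard sfV card_in_imset /=.
  by move: Vv; rewrite -{1}defV => /imsetP[w]; exists w.
have t2: t * t = 1 by rewrite -[t * t]/(t ^+ 2) -ot expg_order.
by rewrite commgEl conjMg conjVg -conjgM t2 conjg1 [RHS]invMg invgK.
Qed.

Lemma inverted_abelian V t : {in V, forall v, v ^ t = v^-1} -> abelian V.
Proof.
move=> invV; apply/centsP => u Vu v Vv.
apply: invg_inj; rewrite -invV ?groupM // conjMg !invV //.
by rewrite invMg.
Qed.

(** Both involutions invert [V], so [s * t^-1] centralizes it. *)
Lemma semiregular_involution_uniq V H s t :
    V :!=: 1 -> H \subset 'N(V) -> semiregular V H ->
  s \in H -> t \in H -> #[s] = 2 -> #[t] = 2 -> s = t.
Proof.
move=> ntV nVH regH Hs Ht os ot.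
have fpf x: x \in H -> #[x] = 2 -> {in V, forall v, v ^ x = v^-1}.
  move=> Hx ox v; apply: fixpoint_free_involution_inverts => //.
    exact: subsetP Hx.
  by apply: regH; rewrite !inE Hx -order_gt1 ox.
apply/eqP; rewrite eq_mulgV1; apply: contraR ntV => nt_st.
have Hst: s * t^-1 \in H^# by rewrite !inE nt_st groupM ?groupV.
rewrite -subG1 -(regH _ Hst) subsetI subxx; apply/subsetP=> v Vv.
apply/cent1P/commgP/conjg_fixP.
by rewrite conjgM (fpf s Hs os v Vv) -(fpf t Ht ot v Vv) conjgK.
Qed.

End FixpointFree.

(** * Commuting distance *)

(* Steps may repeat a vertex, so [near G n x y] says that [x] and [y] are at
   distance at most [n]. *)
Fixpoint near (gT : finGroupType) (G : {set gT}) n (x y : gT) : Prop :=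
  if n is m.+1 then exists z, [/\ z \in G^#, commute x z & near G m z y]
  else x = y.

Section Near.
Variables (gT : finGroupType) (G : {group gT}).
Implicit Types x y z g : gT.

Lemma near1 x y : y \in G^# -> commute x y -> near G 1 x y.
Proof. by move=> Gy cxy; exists y. Qed.

Lemma near_le m n x y : x \in G^# -> m <= n -> near G m x y -> near G n x y.
Proof.
move=> Gx /subnKC <-; move: (n - m) => k.
elim: m x Gx => /= [|m IHm] x Gx; last first.
  by case=> z [Gz cxz /(IHm z Gz) xy]; exists z.
by move=> <-; elim: k => //= k IHk; exists x.
Qed.

Lemma near_trans m n x y z : near G m x y -> near G n y z -> near G (m + n) x z.
Proof.
elim: m x => /= [|m IHm] x; first by move->.
by case=> t [Gt cxt ty] yz; exists t; split=> //; apply: IHm.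
Qed.

Lemma near_sym m x y : x \in G^# -> near G m x y -> near G m y x.
Proof.
elim: m x => //= m IHm x Gx [z [Gz cxz /(IHm z Gz) yz]].
have zx: near G 1 z x by exists x; split=> //; apply/commute_sym.
by have := near_trans yz zx; rewrite addn1.
Qed.

Lemma exists_prime_cycle x :
  x != 1 -> exists y, [/\ y \in <[x]>, y != 1 & prime #[y]].
Proof.
move=> ntx; have pr_p: prime (pdiv #[x]) by rewrite pdiv_prime ?order_gt1.
have [y xy oy] := Cauchy pr_p (pdiv_dvd #[x] : _ %| #|<[x]>|).
by exists y; rewrite -order_gt1 oy prime_gt1.
Qed.

Lemma cycle_commute x y : y \in <[x]> -> commute x y.
Proof. by case/cycleP=> i ->; apply: commuteX. Qed.

Lemma cent1_cycle_sub (V : {set gT}) x y :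
  y \in <[x]> -> 'C_V[x] \subset 'C_V[y].
Proof. by move=> xy; rewrite setIS // -!cent_cycle centS // cycle_subG. Qed.

Lemma exists_commuting_prime x : x \in G^# ->
  exists y, [/\ y \in G^#, y \in <[x]>, commute x y & prime #[y]].
Proof.
case/setD1P=> ntx Gx; have [y [xy nty pr_y]] := exists_prime_cycle ntx.
exists y; split=> //; last exact: cycle_commute.
by rewrite !inE nty (subsetP _ y xy) ?cycle_subG.
Qed.

End Near.

(** * Conjugation into a supplement, and subgroups of prime order *)

Section Conjugation.
Variable gT : finGroupType.
Implicit Types B C D E F G H K L N P Q R S T U V W X Y : {group gT}.

Lemma prime_cent_TI X y : prime #|X| -> y \notin 'C(X) -> 'C_X[y] = 1.
Proof.
move=> pr_X; apply: contraNeq => nt; rewrite -sub_cent1.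
by apply: contraR nt => nsXC; rewrite (prime_TIg pr_X nsXC).
Qed.

Lemma prime_norm_fixpoint X V y :
    prime #|X| -> y \in 'N(X) -> y \notin 'C(X) -> prime #[y] ->
    abelian V -> X \subset 'N(V) -> y \in 'N(V) -> V :!=: 1 -> 'C_V(X) = 1 ->
  'C_V[y] != 1.
Proof.
move=> pr_X nXy ncXy pr_y abV nVX nVy ntV cVX1.
have cXy1 := prime_cent_TI pr_X ncXy.
have ntX: X :!=: 1 by rewrite -cardG_gt1 prime_gt1.
have tiXy: X :&: <[y]> = 1.
  rewrite setIC prime_TIg //; apply: contra ncXy.
  rewrite cycle_subG => Xy; apply: (subsetP _ y Xy).
  exact: cyclic_abelian (prime_cyclic pr_X).
have frob: [Frobenius X <*> <[y]> = X ><| <[y]>].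
  apply/prime_FrobeniusP => //; split; last by rewrite cent_cycle.
  by rewrite sdprodEY // cycle_subG.
rewrite -cent_cycle; apply: (abelian_Frobenius_cent frob abV) => //.
  by rewrite join_subG nVX cycle_subG.
by apply: regular_norm_coprime (prime_semiregular pr_X cVX1).
Qed.

Lemma mulg_coprime_conj G F N x :
    F * N = G -> x \in G -> prime #[x] -> coprime #|F| #[x] ->
  exists2 f, f \in F & x ^ f \in N.
Proof.
move=> defG Gx pr_x coFx; have [sFG sNG] := mulG_sub defG.
have [Q sylQ] := Sylow_exists #[x] N.
have sylQG: #[x].-Sylow(G) Q.
  have [sQN pQ _] := and3P sylQ.
  rewrite pHallE (subset_trans sQN) //= (card_Hall sylQ).
  have := mul_cardG F N; rewrite defG => eqFN.
  have /(congr1 (partn^~ #[x])) := eqFN.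
  rewrite !partnM ?cardG_gt0 //.
  rewrite (part_p'nat (_ : _.-nat #|F|)) ?mul1n; last first.
    by rewrite p'natE // -prime_coprime // coprime_sym.
  rewrite (part_p'nat (_ : _.-nat #|F :&: N|)) ?muln1; last first.
    rewrite p'natE // -prime_coprime // coprime_sym.
    by rewrite (coprimeSg _ coFx) ?subsetIl.
  by move=> ->.
have [||g Gg sxQ] := Sylow_Jsub sylQG (_ : <[x]> \subset G) _.
- by rewrite cycle_subG.
- by rewrite /pgroup -orderE pnat_id.
have xgN: x ^ g \in N.
  apply: (subsetP (pHall_sub sylQ)); apply: (subsetP sxQ).
  by rewrite memJ_conjg cycle_id.
move: Gg xgN; rewrite -defG => /imset2P[f n Ff Nn ->].
by rewrite conjgM memJ_norm ?(subsetP (normG N)) //; exists f.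
Qed.

(** A nontrivial normal subgroup of the [p]-group [R <*> P] meets its centre. *)
Lemma pgroup_cent_neq1 (p : nat) P R :
  p.-group P -> p.-group R -> P \subset 'N(R) -> R :!=: 1 -> 'C_R(P) != 1.
Proof.
move=> pP pR nRP ntR.
have pRP: p.-group (R <*> P) by rewrite norm_joinEr // pgroupM pR.
have nsR: R <| R <*> P by rewrite /(R <| _) joing_subl join_subG normG.
have := meet_center_nil (pgroup_nil pRP) nsR ntR.
apply: contra => /eqP cRP1; rewrite -subG1 -cRP1 setIS //.
by rewrite (subset_trans (subsetIr _ _)) // centS ?joing_subr.
Qed.

(** Otherwise [a] and [b] generate an elementary abelian group of rank 2, which cannot act
    semiregularly. *)
Lemma semiregular_prime_cycle V C a b p :
    V :!=: 1 -> solvable V -> C \subset 'N(V) -> semiregular V C ->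
    a \in C -> b \in C -> commute a b -> prime p -> #[a] = p -> #[b] = p ->
  <[a]> = <[b]>.
Proof.
move=> ntV solV nVC regC Ca Cb cab pr_p oa ob.
apply/eqP; rewrite eqEcard -[#|<[a]>|]/#[a] -[#|<[b]>|]/#[b] oa ob leqnn andbT.
apply: contraT => nsab.
have pr_a: prime #|<[a]>| by rewrite -orderE oa.
have tiab := prime_TIg pr_a nsab.
have cab' : <[b]> \subset 'C(<[a]>).
  by rewrite cent_cycle cycle_subG; apply/cent1P/commute_sym.
have defE: <[a]> \x <[b]> = <[a]> <*> <[b]> by rewrite dprodEY.
have abE: p.-abelem (<[a]> <*> <[b]>).
  rewrite (dprod_abelem p defE) !abelemE // !cycle_abelian.
  by rewrite !(dvdn_trans (exponent_dvdn _)) // -orderE ?oa ?ob.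
suff EC: (<[a]> <*> <[b]>)%G \in 'E_p^2(C).
  by case: (semiregular_no_rank2 ntV solV nVC regC EC).
rewrite pnElemE // !inE join_subG !cycle_subG Ca Cb abE /=.
by rewrite -(dprod_card defE) -!orderE oa ob.
Qed.

(** [N] acts on [X] through [Aut X], which is abelian. *)
Lemma der1_norm_cyclic N X : cyclic X -> N \subset 'N(X) -> N^`(1) \subset 'C(X).
Proof.
move=> cycX nXN; have nX := subsetP nXN.
rewrite -ker_conj_aut gen_subG; apply/subsetP=> _ /imset2P[x y Nx Ny ->].
have Axy z: z \in N -> conj_aut X z \in Aut X.
  move=> Nz; apply: (subsetP (Aut_conj_aut X N)).
  by rewrite mem_morphim ?nX.
apply/kerP; first by rewrite groupR ?nX.
rewrite morphR ?nX //; apply/eqP/commgP.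
by apply: (centsP (Aut_cyclic_abelian cycX)); apply: Axy.
Qed.

End Conjugation.

(** * The commuting graph of a soluble group *)

Section Parker.
Variables (gT : finGroupType) (G : {group gT}).
Hypothesis solG : solvable G.
Implicit Types (x y z u v w c e f g : gT) (C M N P Q R S T X : {group gT}).
Let F := 'F(G)%G.
Let Z := 'Z(F)%G.

Let sFG : F \subset G. Proof. exact: Fitting_sub. Qed.
Let nFG : G \subset 'N(F). Proof. exact: normal_norm (Fitting_normal G). Qed.
Let sZF : Z \subset F. Proof. exact: center_sub. Qed.
Let nZG : G \subset 'N(Z). Proof. exact: char_norm_trans (center_char F) nFG. Qed.
Let cFZ f z : f \in F -> z \in Z -> commute f z.
Proof. by move=> Ff /centerP[_ cFz]; apply/commute_sym/cFz. Qed.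

Lemma near_fixpoint u z :
  u \in G^# -> 'C_F[u] != 1 -> z \in Z -> z != 1 -> near G 2 u z.
Proof.
move=> Gu /trivgPn[f /setIP[Ff /cent1P cuf] ntf] Zz ntz.
have inG a : a \in F -> a != 1 -> a \in G^#.
  by move=> Fa nta; rewrite !inE nta (subsetP sFG).
exists f; split=> //; first exact: inG.
exists z; split=> //; last exact: cFZ.
by rewrite inG ?(subsetP sZF).
Qed.

Lemma prime_fixpoint_free_coprime u :
  u \in G -> prime #[u] -> 'C_F[u] = 1 -> coprime #|F| #[u].
Proof.
move=> Gu pr_u cFu; apply: regular_norm_coprime.
  by rewrite cycle_subG (subsetP nFG).
by apply: prime_semiregular => //; rewrite cent_cycle.
Qed.

(** A prime-order power [u] of [v] either has a fixed point in [F], hence is close to [z], or is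
    conjugated into [N] by some [f] in [F]. Since [f] fixes [z], the path from [u ^ f] through [c]
    and [y] to [z] can be conjugated back without moving its end. *)
Lemma near_hub N y z :
    F * N = G -> y \in G^# -> z \in Z -> z != 1 -> commute y z ->
    (forall u, u \in N -> prime #[u] -> 'C_F[u] = 1 ->
      exists2 c, c \in G^# & commute u c /\ commute c y) ->
  forall v, v \in G^# -> near G 4 v z.
Proof.
move=> defG Gy Zz ntz cyz hub v Gv.
have [u [Gu vu cvu pr_u]] := exists_commuting_prime Gv.
have [cFu | fixu] := eqVneq ('C_F[u]) 1; last first.
  have vz: near G 3 v z by exists u; split=> //; apply: near_fixpoint.
  exact: (near_le Gv _ vz).
have [_ Gu1] := setD1P Gu.
have coFu := prime_fixpoint_free_coprime Gu1 pr_u cFu.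
have [f Ff Nuf] := mulg_coprime_conj defG Gu1 pr_u coFu.
have [||c Gc [cuc ccy]] := hub _ Nuf.
- by rewrite orderJ.
- by rewrite -(normsP (normG F) f Ff) cent1J -conjIg cFu conjs1g.
have Gf : f^-1 \in G by rewrite groupV (subsetP sFG).
have GJ a : a \in G^# -> a ^ f^-1 \in G^#.
  by case/setD1P=> nta Ga; rewrite !inE conjg_eq1 nta memJ_norm ?(subsetP (normG G)).
have cJ a b : commute a b -> commute (a ^ f^-1) (b ^ f^-1).
  by move=> cab; rewrite /commute -!conjMg cab.
exists u; split=> //.
exists (c ^ f^-1); split; [exact: GJ | by rewrite -{1}(conjgK f u); apply: cJ|].
exists (y ^ f^-1); split; [exact: GJ | exact: cJ|].
exists z; split=> //; first by rewrite !inE ntz (subsetP sFG) // (subsetP sZF).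
have <- : z ^ f^-1 = z by apply/conjg_fixP/commgP/commute_sym/cFZ; rewrite ?groupV.
by apply: cJ.
Qed.

Lemma near8 z :
  z \in G^# -> {in G^#, forall v, near G 4 v z} -> {in G^# &, forall u v, near G 8 u v}.
Proof.
move=> Gz nz u v Gu Gv; apply: (near_trans (m := 4) (n := 4) (nz u Gu)).
by apply: (near_sym Gv); apply: nz.
Qed.

Definition Parker_conclusion :=
  [\/ [Frobenius G], two_Frobenius G | {in G^# &, forall u v, near G 8 u v}].

Hypothesis ntG : G :!=: 1.

Let ntF : F :!=: 1. Proof. by rewrite trivg_Fitting. Qed.
Let nilF : nilpotent F. Proof. exact: Fitting_nil. Qed.
Let solF : solvable F. Proof. exact: nilpotent_sol. Qed.
Let ntZ : Z :!=: 1. Proof. by rewrite center_nil_eq1. Qed.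
Let abZ : abelian Z. Proof. exact: center_abelian. Qed.
Let ZtoG z : z \in Z -> z != 1 -> z \in G^#.
Proof. by move=> Zz ntz; rewrite !inE ntz (subsetP sFG) ?(subsetP sZF). Qed.

Lemma Parker_Frobenius N :
  F * N = G -> N :!=: 1 -> semiregular F N -> Parker_conclusion.
Proof.
move=> defG ntN regN; apply: Or31.
have [_ sNG] := mulG_sub defG.
have nFN := subset_trans sNG nFG.
have coFN := regular_norm_coprime nFN regN.
have sdG: F ><| N = G by rewrite sdprodE ?coprime_TIg.
exact: FrobeniusW (introT (Frobenius_semiregularP sdG ntF ntN) regN).
Qed.

(** If [u] did not centralize [<[x]>], the two would generate a Frobenius group with kernel [<[x]>];
    as [x] has no fixed points on [Z], [u] would have one. *)
Lemma cycle_norm_commute x u :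
    x \in G -> prime #[x] -> 'C_F[x] = 1 -> u \in G -> u \in 'N(<[x]>) -> prime #[u] ->
  'C_Z[u] = 1 -> commute u x.
Proof.
move=> Gx pr_x cFx Gu nxu pr_u /eqP cZu; apply/cent1P; apply: contraLR cZu => ncux.
apply: (@prime_norm_fixpoint _ <[x]>%G) => //.
- by rewrite cent_cycle.
- by rewrite cycle_subG (subsetP nZG).
- exact: (subsetP nZG).
by apply/trivgP; rewrite -cFx -cent_cycle setSI.
Qed.

(** Here [y] is the hub. It fixes some [z != 1] in [Z], since otherwise it would lie in [C], which
    is semiregular on [F]. A prime-order [u] in [N] without fixed points on [F] lies in [C], and
    must be joined to [y] through an element [c] of [C]. *)
Lemma two_Frobenius_hub x : let C := 'C_G[x]%G in let N := 'N_G(<[x]>)%G in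
    x \in G -> prime #[x] -> semiregular F C -> F * N = G ->
    (exists y, [/\ y \in N, prime #[y], 'C_F[y] != 1 &
       exists2 c, c \in C^# & commute y c]) ->
  {in G^# &, forall u v, near G 8 u v}.
Proof.
move=> C N Gx pr_x regC defG [y [Ny pr_y fixy [c0 C1c0 cyc0]]].
have ntx : x != 1 by rewrite -order_gt1 prime_gt1.
have Cx : x \in C by rewrite inE Gx cent1id.
have cFx : 'C_F[x] = 1 by apply: regC; apply/setD1P.
have sCG : C \subset G := subsetIl _ _.
have sCN : C \subset N by rewrite subsetI sCG subcent1_cycle_norm.
have nFC : C \subset 'N(F) := subset_trans sCG nFG.
have Gy : y \in G := subsetP (subsetIl _ _) y Ny.
have nty : y != 1 by rewrite -order_gt1 prime_gt1.
have primeC u : u \in N -> prime #[u] -> 'C_Z[u] = 1 -> u \in C.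
  case/setIP=> Gu nxu pr_u cZu; rewrite inE Gu; apply/cent1P.
  exact: cycle_norm_commute.
have fixZ : 'C_Z[y] != 1.
  apply: contra fixy => /eqP cZy; apply/eqP/regC; apply/setD1P; split=> //; exact: primeC.
have [z /setIP[Zz /cent1P czy] ntz] := trivgPn _ fixZ.
suff hub u : u \in N -> prime #[u] -> 'C_F[u] = 1 ->
    exists2 c, c \in G^# & commute u c /\ commute c y.
  apply: (near8 (ZtoG Zz ntz)) => v Gv; apply: (near_hub (y := y) defG _ Zz ntz) Gv => //.
  exact/setD1P.
move=> Nu pr_u cFu; have {Nu} Cu : u \in C.
  by apply: primeC => //; apply/trivgP; rewrite -cFu setSI.
(* In odd order, elements of prime order of [C] commute; otherwise the unique
   involution of [C] is central in [N]. *)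
have [oddC | ] := boolP (odd #|C|).
  have [Gc0 ntc0] : c0 \in C /\ c0 != 1 by have /setD1P[] := C1c0.
  have [c [c0c ntc pr_c]] := exists_prime_cycle ntc0.
  have Cc : c \in C by rewrite (subsetP _ c c0c) ?cycle_subG.
  exists c; first by rewrite !inE ntc (subsetP sCG).
  split; last first.
    by apply/cent1P; rewrite (subsetP _ c c0c) // cycle_subG; apply/cent1P/commute_sym.
  apply: (odd_semiregular_prime_commute ntF solF _ nFC regC oddC) => //.
  exact: solvableS sCG solG.
rewrite -dvdn2 => /Cauchy[] // t Ct ot.
have ntt : t != 1 by rewrite -order_gt1 ot.
have ctN n : n \in N -> commute n t.
  move=> Nn; apply/commute_sym/commgP/conjg_fixP.
  apply: (semiregular_involution_uniq ntF nFC regC) => //; last by rewrite orderJ.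
  have nCN : N \subset 'N(C).
    by rewrite /= -cent_cycle normsI ?norms_cent ?subsetIr // subIset ?normG.
  by rewrite memJ_norm // (subsetP nCN).
exists t; first by rewrite !inE ntt (subsetP sCG).
by split; [apply: ctN; apply: (subsetP sCN) | apply/commute_sym/ctN].
Qed.

(* A prime [p] dividing both numbers gives a Sylow [p]-subgroup [P] of [N], not
   inside [C], normalized by a conjugate of [y], which centralizes [P / (C :&: P)]:
   then [P] has elements of order [p] outside [C], which centralize some of
   [C :&: P]. *)
Lemma coprime_regular_index C N y :
    C <| N -> N^`(1) \subset C -> y \in N -> prime #[y] -> y \notin C ->
    {in N, forall u, prime #[u] -> u \notin C -> 'C_C[u] = 1} ->
  coprime #|C| #|N : C|.
Proof.
move=> nsCN sN'C Ny pr_y nCy fixC; have [sCN nCN] := andP nsCN.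
have coCy : coprime #|C| #[y].
  apply: (@regular_norm_coprime _ C <[y]>%G); first by rewrite cycle_subG (subsetP nCN).
  by apply: prime_semiregular => //; rewrite cent_cycle fixC.
apply: contraT => ncoC; pose p := pdiv (gcdn #|C| #|N : C|).
have pr_p : prime p.
  by rewrite pdiv_prime // ltn_neqAle eq_sym ncoC gcdn_gt0 cardG_gt0.
have p_dv_C : p %| #|C| := dvdn_trans (pdiv_dvd _) (dvdn_gcdl _ _).
have p_dv_NC : p %| #|N : C| := dvdn_trans (pdiv_dvd _) (dvdn_gcdr _ _).
have [P sylP] := Sylow_exists p N; have [sPN pP _] := and3P sylP.
have sylCP := Sylow_setI_normal nsCN sylP.
have ntCP : C :&: P != 1.
  by rewrite -cardG_gt1 (card_Hall sylCP) p_part_gt1 mem_primes pr_p cardG_gt0.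
have nsPC : ~~ (P \subset C).
  have := quotient_pHall (subset_trans sPN nCN) sylP.
  apply: contraL => /quotientS1 ->; apply/negP => /card_Hall/esym/eqP.
  rewrite cards1 card_quotient // p_part_eq1 mem_primes pr_p p_dv_NC.
  by rewrite indexg_gt0.
have nsCPN : C <*> P <| N.
  by rewrite sub_der1_normal ?join_subG ?sCN // (subset_trans sN'C) ?joing_subl.
have defN : C * 'N_N(P) = N.
  rewrite -[RHS](Frattini_arg nsCPN (pHall_subl (joing_subr C P) (normal_sub nsCPN) sylP)).
  rewrite /= norm_joinEr ?(subset_trans sPN) // -mulgA; congr (_ * _).
  by rewrite mulSGid // subsetI sPN normG.
have [f Cf /setIP[Ny1 nPy1]] := mulg_coprime_conj defN Ny pr_y coCy.
set y1 := y ^ f in Ny1 nPy1.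
have cCy1 : 'C_C[y1] = 1.
  by rewrite -(normsP (normG C) f Cf) cent1J -conjIg fixC ?conjs1g.
(* [y1] acts trivially on [P / (C :&: P)] because the derived subgroup of [N] lies in [C]. By
   coprimeness, having no fixed point in [P] would make this quotient trivial. *)
have ntPy1 : 'C_P[y1] != 1.
  apply: contra nsPC => /eqP cPy1.
  have snPy1 : <[y1]> \subset 'N(P) by rewrite cycle_subG.
  have snCPy1 : <[y1]> \subset 'N(C :&: P).
    by rewrite normsI // cycle_subG (subsetP nCN).
  have coPy1 : coprime #|P| #|<[y1]>|.
    rewrite -orderE orderJ (pnat_coprime pP) // p'natE // -prime_coprime //.
    exact: coprime_dvdl p_dv_C coCy.
  have := coprime_quotient_cent (subsetIr C P) snCPy1 coPy1 (pgroup_sol pP).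
  rewrite cent_cycle cPy1 quotient1 (setIidPl _); last first.
    rewrite quotient_cents2 //; last by rewrite normsI ?normG ?(subset_trans sPN nCN).
    rewrite subsetI andbC commg_subl snPy1 (subset_trans _ sN'C) //.
    by rewrite commgSS // cycle_subG.
  move/esym/eqP; rewrite -subG1 quotient_sub1 ?subsetI; first by case/andP.
  by rewrite normsI ?normG ?(subset_trans sPN nCN).
have [e0 /setIP[Pe0 cye0] nte0] := trivgPn _ ntPy1.
have [e [e0e nte pr_e]] := exists_prime_cycle nte0.
have se0 X : e0 \in X -> e \in X.
  by move=> Xe0; rewrite (subsetP _ e e0e) // cycle_subG.
have Pe : e \in P := se0 P Pe0.
have [Ce | nCe] := boolP (e \in C).
  case/negP: nte; rewrite -in_set1 -[[set 1]]cCy1 inE Ce.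
  exact: (se0 'C[y1]%G).
have cCe := fixC e (subsetP sPN e Pe) pr_e nCe.
have: 'C_(C :&: P)(<[e]>) != 1.
  apply: (pgroup_cent_neq1 (p := p)) => //.
  - by rewrite (pgroupS _ pP) ?cycle_subG.
  - by rewrite (pgroupS _ pP) ?subsetIr.
  by rewrite cycle_subG (subsetP _ e Pe) // normsI ?normG ?(subset_trans sPN).
by case/negP; rewrite -subG1 -cCe /= cent_cycle setSI ?subsetIl.
Qed.

(** Three outcomes: [N] is semiregular on [F] and [G] is Frobenius; some prime-order [y] in [N] with
    fixed points on both [F] and [C] is a hub; or prime-order elements of [N] outside [C] act on [C]
    without fixed points. In the last case [C] is a normal Hall subgroup of [N], and a
    Schur-Zassenhaus complement [M] completes the 2-Frobenius decomposition. *)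
Lemma Parker_cent_semiregular_mulF x : let C := 'C_G[x]%G in let N := 'N_G(<[x]>)%G in
    x \in G -> prime #[x] -> semiregular F C -> F * N = G -> Parker_conclusion.
Proof.
move=> C N Gx pr_x regC defG.
have ntx : x != 1 by rewrite -order_gt1 prime_gt1.
have Cx : x \in C by rewrite inE Gx cent1id.
have cFx : 'C_F[x] = 1 by apply: regC; apply/setD1P.
have sCG : C \subset G := subsetIl _ _.
have sNG : N \subset G := subsetIl _ _.
have sCN : C \subset N by rewrite subsetI sCG subcent1_cycle_norm.
have nCN : N \subset 'N(C).
  by rewrite /= -cent_cycle normsI ?norms_cent ?subsetIr // subIset ?normG.
have nFC : C \subset 'N(F) := subset_trans sCG nFG.
have nFN : N \subset 'N(F) := subset_trans sNG nFG.
have coFC := regular_norm_coprime nFC regC.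
have ntN : N :!=: 1 by apply/trivgPn; exists x => //; apply: subsetP Cx.
have ntC : C :!=: 1 by apply/trivgPn; exists x.
have [/forall_inP regN | ] := boolP [forall n in N^#, 'C_F[n] == 1].
  by apply: (Parker_Frobenius defG ntN) => n /regN/eqP.
rewrite negb_forall_in => /exists_inP[n /setD1P[ntn Nn] fixn].
have [/exists_inP[y Ny /and3P[pr_y fixy /trivgPn[c /setIP[Cc /cent1P cyc] ntc]]] | noP] :=
  boolP [exists y in N, [&& prime #[y], 'C_F[y] != 1 & 'C_C[y] != 1]].
  apply/Or33/(two_Frobenius_hub Gx pr_x regC defG); exists y; split=> //.
  by exists c => //; apply/setD1P.
have fixP u : u \in N -> prime #[u] -> 'C_F[u] != 1 -> 'C_C[u] = 1.
  move=> Nu pr_u fixu; apply/eqP; apply: contraNT noP => cu.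
  by apply/exists_inP; exists u => //; rewrite pr_u fixu.
have fixC u : u \in N -> prime #[u] -> u \notin C -> 'C_C[u] = 1.
  move=> Nu pr_u nCu; have [Gu nxu] := setIP Nu.
  apply: fixP => //; apply: contra nCu => /eqP cFu; rewrite inE Gu.
  apply/cent1P/cycle_norm_commute => //.
  by apply/trivgP; rewrite -cFu setSI.
have [y [ny nty pr_y]] := exists_prime_cycle ntn.
have Ny : y \in N by rewrite (subsetP _ y ny) ?cycle_subG.
have fixy : 'C_F[y] != 1.
  apply: contra fixn => /eqP cFy; rewrite -subG1 -cFy.
  exact: cent1_cycle_sub.
have nCy : y \notin C.
  by apply: contra fixy => Cy; apply/eqP/regC/setD1P.
have cCy := fixC y Ny pr_y nCy.
have sN'C : N^`(1) \subset C.
  rewrite subsetI (subset_trans (der_sub 1 N)) //= -cent_cycle.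
  by apply: der1_norm_cyclic (cycle_cyclic x) _; apply: subsetIr.
have hallC : Hall N C.
  rewrite /Hall sCN; apply: coprime_regular_index Ny pr_y nCy _ => //.
  exact/andP.
have nsCN : C <| N by apply/andP.
have [M /complP[tiCM defN]] := splitsP (SchurZassenhaus_split hallC nsCN).
have sMN : M \subset N by rewrite -defN mulG_subr.
have sdN : C ><| M = N by rewrite sdprodE // (subset_trans sMN).
have regM : semiregular C M.
  move=> m /setD1P[ntm Mm]; have [e [me nte pr_e]] := exists_prime_cycle ntm.
  have Me : e \in M by rewrite (subsetP _ e me) ?cycle_subG.
  apply/trivgP; rewrite -(fixC e) //; [exact: cent1_cycle_sub | exact: subsetP Me |].
  by apply: contra nte => Ce; rewrite -in_set1 -[[set 1]]tiCM inE Ce.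
have ntM : M :!=: 1.
  by apply: contra nCy => /eqP M1; move: Ny; rewrite -defN M1 mulg1.
have sdFC : F ><| C = F * C by rewrite sdprodE ?coprime_TIg.
apply/Or32; exists F, C, M; split.
- exact: Fitting_normal.
- rewrite -(norm_joinEr nFC) /normal join_subG sFG sCG /=.
  have nFF : F \subset 'N(F <*> C) by rewrite (subset_trans (joing_subl F C)) ?normG.
  by rewrite -{1}defG mul_subG // normsY.
- rewrite -(norm_joinEr nFC) in sdFC *.
  exact: introT (Frobenius_semiregularP sdFC ntF ntC) regC.
- by rewrite defN; exact: introT (Frobenius_semiregularP sdN ntC ntM) regM.
by rewrite -mulgA defN.
Qed.

Lemma mulF_Sylow T P (p : nat) :
  T \subset G -> F \subset T -> p.-group (T / F) -> p.-Sylow(T) P -> F * P = T.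
Proof.
move=> sTG sFT pTF sylP; have sPT := pHall_sub sylP.
have nFT := subset_trans sTG nFG.
apply/eqP; rewrite eqEsubset mul_subG //= -quotientSK //.
by rewrite (pHall_id (quotient_pHall (subset_trans sPT nFT) sylP) pTF).
Qed.

(** The Frattini argument gives [F * 'N_G(P) = G]. Lying in the semiregular group [C], ['Z(P)] has
    only one subgroup of order [p], so ['N_G(P)] normalizes [<[e]>]. *)
Lemma Frattini_center_prime T P C (p : nat) e :
    T <| G -> F * P = T -> p.-Sylow(T) P -> prime p ->
    C \subset G -> semiregular F C -> 'Z(P) \subset C -> e \in 'Z(P) -> #[e] = p ->
  F * 'N_G(<[e]>) = G.
Proof.
move=> nsTG defT sylP pr_p sCG regC sZC Ze oe.
apply/eqP; rewrite eqEsubset mul_subG ?subsetIl //=.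
rewrite -{1}(Frattini_arg nsTG sylP) -defT -mulgA mulgS //.
have sPT := pHall_sub sylP.
rewrite mulSGid; last first.
  by rewrite subsetI normG (subset_trans sPT) ?normal_sub.
apply/subsetP=> n /setIP[Gn nPn]; rewrite inE Gn /=.
have Zen : e ^ n \in 'Z(P).
  by rewrite memJ_norm // (subsetP (char_norm_trans (center_char P) (subxx _))).
rewrite inE -cycleJ.
rewrite (semiregular_prime_cycle ntF solF (subset_trans sCG nFG) regC (p := p)
   (subsetP sZC _ Zen) (subsetP sZC _ Ze)) ?orderJ //.
apply: (centsP (center_abelian P)) => //.
Qed.

(** If ['O_r(G / F)] is nontrivial, [<[x]>] itself satisfies the previous reduction. Otherwise [x]
    acts nontrivially on some ['O_s(G / F)] with [s != r], and a central element [e] of order [s]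
    replaces it. *)
Lemma Parker_cent_semiregular x : let C := 'C_G[x]%G in
  x \in G -> prime #[x] -> semiregular F C -> Parker_conclusion.
Proof.
move=> C Gx pr_x regC; set r := #[x] in pr_x.
have ntx : x != 1 by rewrite -order_gt1 prime_gt1.
have Cx : x \in C by rewrite inE Gx cent1id.
have cFx : 'C_F[x] = 1 by apply: regC; apply/setD1P.
have sCG : C \subset G := subsetIl _ _.
have nFC : C \subset 'N(F) := subset_trans sCG nFG.
have coFC := regular_norm_coprime nFC regC.
have sxC : <[x]> \subset C by rewrite cycle_subG.
have sxG := subset_trans sxC sCG.
have coFx : coprime #|F| r := coprimegS sxC coFC.
have rx : r.-group <[x]> by rewrite /pgroup pnat_id.
have solGF := quotient_sol 'F(G) solG.
have [O1 | ntO] := eqVneq ('O_r(G / F)) 1; last first.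
  have [T [charT sFT defT]] := exists_pcore_preim r (Fitting_char G).
  have [sTG nTG] := andP (char_normal charT).
  have rTF : r.-group (T / F) by rewrite defT pcore_pgroup.
  have [R sylR sxR] := Sylow_superset sxG rx.
  have sylRT := Sylow_setI_normal (char_normal charT) sylR.
  have mulFR := mulF_Sylow sTG sFT rTF sylRT.
  have ntRT : T :&: R != 1.
    apply: contra ntO => /eqP RT1; rewrite -defT -mulFR /= RT1 mulg1.
    by rewrite trivg_quotient.
  have [_ rR _] := and3P sylR.
  have cent_cycle_x e : e \in T :&: R -> commute e x -> #[e] = r -> <[e]> = <[x]>.
    case/setIP=> Te Re cex oe.
    have Ce : e \in C by rewrite inE (subsetP sTG) //; apply/cent1P.
    exact: (semiregular_prime_cycle ntF solF nFC regC Ce Cx cex pr_x).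
  have rRT : r.-group (T :&: R) := pgroupS (subsetIr _ _) rR.
  have pick_r (H : {group gT}) : r.-group H -> H :!=: 1 -> exists2 e, e \in H & #[e] = r.
    by move=> rH /(pgroup_pdiv rH)[_ rdvH _]; have [e] := Cauchy pr_x rdvH; exists e.
  (* [x] normalizes the [r]-group [T :&: R], so it commutes with an element of order [r] there;
     inside [C] this element must generate [<[x]>]. *)
  have RTx : x \in T :&: R.
    have nRTx : <[x]> \subset 'N(T :&: R).
      by rewrite normsI ?(subset_trans sxG nTG) ?(subset_trans sxR) ?normG.
    have [e /setIP[RTe cxe] oe] := pick_r _ (pgroupS (subsetIl _ _) rRT)
                       (pgroup_cent_neq1 rx rRT nRTx ntRT).
    rewrite /= cent_cycle in cxe.
    rewrite -cycle_subG -(cent_cycle_x e RTe) ?cycle_subG //; exact/cent1P.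
  have ntZ' : 'Z(T :&: R) != 1 by rewrite center_nil_eq1 ?(pgroup_nil rRT).
  have [e Ze oe] := pick_r _ (pgroupS (center_sub (T :&: R)%G) rRT) ntZ'.
  have /centerP[RTe cRTe] := Ze.
  have eqex : <[e]> = <[x]> by apply: cent_cycle_x => //; apply: cRTe.
  have sZC : 'Z(T :&: R) \subset C.
    apply/subsetP=> z /centerP[/setIP[Tz Rz] cz]; rewrite inE (subsetP sTG) //.
    by apply/cent1P/cz.
  have := Frattini_center_prime (char_normal charT) mulFR sylRT pr_x sCG regC sZC Ze oe.
  by rewrite eqex; apply: Parker_cent_semiregular_mulF.
have xF : x \notin F.
  apply: contra ntx => Fx; rewrite -in_set1 -[[set 1]]cFx.
  by rewrite inE Fx cent1id.
have nFx := subsetP nFG x Gx.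
(* If [coset F x] centralized ['F(G / F)], it would lie in it, hence in its trivial [r]-part, and
   [x] would be in [F]. *)
have [s ncs] : exists s : nat, ~~ ('O_s(G / F) \subset 'C[coset F x]).
  suff ncF2 : ~~ ('F(G / F) \subset 'C[coset F x]).
    have /existsP[s ncs] : [exists s : 'I_#|G / F|.+1, ~~ ('O_s(G / F) \subset 'C[coset F x])].
      rewrite -negb_forall; apply: contra ncF2 => /forallP cO.
      by rewrite FittingEgen gen_subG; apply/bigcupsP=> s _; apply: cO.
    by exists s.
  apply: contra xF => cF2.
  have GFx : coset F x \in G / F by apply: mem_quotient.
  have F2x : coset F x \in 'F(G / F).
    apply: (subsetP (cent_sub_Fitting solGF)).
    by rewrite inE GFx /= -sub_cent1.
  have : coset F x \in 'O_r('F(G / F)).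
    rewrite (mem_Hall_pcore (nilpotent_pcore_Hall r (Fitting_nil _)) F2x).
    exact: morph_p_elt.
  by rewrite p_core_Fitting O1 => /set1P; apply: coset_idr.
have ntO : 'O_s(G / F) != 1 by apply: contra ncs => /eqP->; apply: sub1G.
have [pr_s s_dv_O _] := pgroup_pdiv (pcore_pgroup s (G / F)) ntO.
have s'r : s != r by apply: contra ntO => /eqP->; apply/eqP.
have [T [charT sFT defT]] := exists_pcore_preim s (Fitting_char G).
have [sTG nTG] := andP (char_normal charT).
have sTF : s.-group (T / F) by rewrite defT pcore_pgroup.
have coTx : coprime #|T| #|<[x]>|.
  have [nFT oF] := (subset_trans sTG nFG, coFx).
  rewrite -(Lagrange sFT) coprimeMl -orderE coFx -card_quotient //.
  by rewrite (pnat_coprime sTF) // p'natE // dvdn_prime2 // eq_sym.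
have solx : solvable <[x]> := abelian_sol (cycle_abelian x).
have [S sylS nSx] := sol_coprime_Sylow_exists s solx (subset_trans sxG nTG) coTx.
have [sST sS _] := and3P sylS; have sSG := subset_trans sST sTG.
have mulFS := mulF_Sylow sTG sFT sTF sylS.
have ncSx : ~~ (<[x]> \subset 'C(S)).
  apply: contra ncs => cSx; rewrite -defT -mulFS quotientMidl.
  rewrite sub_cent1; apply/centP=> _ /morphimP[u nFu Su ->].
  by rewrite /commute -!morphM // (centP (subsetP cSx x (cycle_id x)) u Su).
(* Otherwise [T] would lie in [F]. Consequently [s] divides [#|C|], which makes [S] coprime to
   [F]. *)
have ntSx : 'C_S(<[x]>) != 1.
  apply: contra ntO => /eqP cSx; rewrite -defT; apply/eqP/quotientS1.
  apply: (fixpoint_free_Sylow_sub_Fitting solG (subset_trans sxG (normG G)) _ s'r pr_s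
            (char_normal charT) sFT sTF sylS nSx cSx) => //.
  by rewrite cent_cycle.
have s_dv_C : s %| #|C|.
  have [_ sdv _] := pgroup_pdiv (pgroupS (subsetIl S 'C(<[x]>)) sS) ntSx.
  apply: dvdn_trans sdv _; rewrite cardSg //= cent_cycle.
  by rewrite setSI.
have coFS : coprime #|F| #|S|.
  rewrite coprime_sym (pnat_coprime sS) // p'natE // -prime_coprime // coprime_sym.
  exact: coprime_dvdr s_dv_C coFC.
(* A nontrivial [[~: D, <[x]>]] would be a Frobenius kernel with complement [<[x]>], so it would
   centralize [F] and lie in [F :&: S], which is trivial. *)
have centD (D : {group gT}) :
    abelian D -> D \subset S -> <[x]> \subset 'N(D) -> D \subset 'C(<[x]>).
  move=> abD sDS nDx; apply/commG1P; apply: contraTeq isT => ntDx.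
  have sDD : [~: D, <[x]>] \subset D by rewrite commg_subl.
  have sDS' := subset_trans sDD sDS.
  have coDx : coprime #|D| #|<[x]>| := coprimeSg (subset_trans sDS sST) coTx.
  have nDDx : <[x]> \subset 'N([~: D, <[x]>]) by rewrite normsR ?normG.
  have frob: [Frobenius [~: D, <[x]>] <*> <[x]> = [~: D, <[x]>] ><| <[x]>].
    apply/prime_FrobeniusP => //; split; last exact: coprime_abel_cent_TI.
    by rewrite sdprodEY // coprime_TIg // (coprimeSg sDD).
  have cFD : [~: D, <[x]>] \subset 'C(F).
    apply: (Frobenius_fixpoint_free_cent frob _ solF).
    - by rewrite join_subG !(subset_trans _ nFG) // (subset_trans sDS').
    - rewrite /= norm_joinEr // TI_cardMg ?coprime_TIg ?(coprimeSg sDD) //.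
      by rewrite coprimeMr (coprimegS sDS').
    by rewrite cent_cycle.
  case/negP: ntDx; rewrite -subG1 -(coprime_TIg coFS) subsetI sDS' andbT.
  by apply: subset_trans (cent_sub_Fitting solG); rewrite subsetI (subset_trans sDS').
have sZC : 'Z(S) \subset C.
  rewrite subsetI (subset_trans (center_sub S)) //= -cent_cycle.
  apply: centD (center_abelian S) (center_sub S) _.
  exact: char_norm_trans (center_char S) nSx.
have nabS : ~~ abelian S by apply: contra ncSx => abS; rewrite centsC centD.
have ntS : S :!=: 1 by apply: contra nabS => /eqP->; apply: abelian1.
have ntZS : 'Z(S) != 1 by rewrite center_nil_eq1 ?(pgroup_nil sS).
have [_ s_dv_Z _] := pgroup_pdiv (pgroupS (center_sub S) sS) ntZS.
have [e Ze oe] := Cauchy pr_s s_dv_Z.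
have Ce : e \in C := subsetP sZC e Ze.
have nte : e != 1 by rewrite -order_gt1 oe prime_gt1.
have Ge : e \in G := subsetP sCG e Ce.
have cFe : 'C_F[e] = 1 by apply: regC; apply/setD1P.
have pr_e : prime #[e] by rewrite oe.
have defG := Frattini_center_prime (char_normal charT) mulFS sylS pr_s sCG regC sZC Ze oe.
(* The intermediate vertex is [e] itself: elements of prime order in ['N_G(<[e]>)] without fixed
   points on [F] commute with it. *)
have hub y z : z \in Z -> z != 1 -> y \in G^# -> commute y z -> commute y e ->
    {in G^# &, forall u v, near G 8 u v}.
  move=> Zz ntz Gy cyz cye; apply: (near8 (ZtoG Zz ntz)) => v Gv.
  apply: (near_hub defG Gy Zz ntz cyz _ Gv) => u /setIP[Gu neu] pr_u cFu.
  exists e; first exact/setD1P.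
  split=> //; apply: cycle_norm_commute => //.
  by apply/trivgP; rewrite -cFu setSI.
(* An involution [e] inverts [F], whence [Z = F] and ['N_G(<[e]>)] centralizes
   [e]; for odd [s], [S] has rank at least 2 since it is not abelian. *)
have [s2 | odd_s] := even_prime pr_s.
  have invF v : v \in F -> v ^ e = v^-1.
    by apply: fixpoint_free_involution_inverts => //; rewrite ?oe // (subsetP nFG).
  have abF : abelian F := inverted_abelian invF.
  have defZ : Z = F by apply: val_inj; apply/center_idP.
  have [/forall_inP regN | ] := boolP [forall n in ('N_G(<[e]>))^#, 'C_F[n] == 1].
    apply: (@Parker_Frobenius 'N_G(<[e]>)%G defG) => [|n /regN/eqP //].
    apply/trivgPn; exists e => //.
    by rewrite inE Ge (subsetP (normG _)) ?cycle_id.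
  rewrite negb_forall_in => /exists_inP[n /setD1P[ntn /setIP[Gn nen]]].
  case/trivgPn=> z /setIP[Fz /cent1P czn] ntz; apply: Or33.
  apply: (hub n z) => //; [by rewrite defZ | exact/setD1P |].
  apply/commute_sym/commgP/conjg_fixP.
  have : e ^ n \in <[e]> by rewrite memJ_norm ?cycle_id.
  rewrite cycle2g ?oe // !inE conjg_eq1 (negPf nte) /= => /eqP //.
have oddS : odd #|S|.
  by rewrite (card_Hall sylS) p_part oddX odd_s orbT.
have rkS : 1 < 'r_s(S).
  rewrite ltnNge -(odd_pgroup_rank1_cyclic sS oddS).
  by apply: contra nabS; apply: cyclic_abelian.
have [E ES] := p_rank_geP rkS.
have [sES abE dE] := pnElemP ES.
have EE : E \in 'E_s^2(E) by apply/pnElemP.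
have coZs : coprime #|Z| s.
  exact: coprimeSg sZF (coprime_dvdr s_dv_C coFC).
(* The hub [w] is taken in [E]: it fixes a nontrivial [z] in [Z], and commutes with [e] because [e]
   is central in [S]. *)
have [] := rank2_fixpoint EE abZ (subset_trans sES (subset_trans sSG nZG)) ntZ coZs.
move=> w /setD1P[ntw Ew] /trivgPn[z /setIP[Zz /cent1P czw] ntz].
have Sw := subsetP sES w Ew.
apply/Or33/(hub w z) => //; first by apply/setD1P; rewrite (subsetP sSG).
have /centerP[_ cSe] := Ze.
by apply/commute_sym/cSe.
Qed.

Theorem Parker_dichotomy : Parker_conclusion.
Proof.
have [/existsP[x /and3P[Gx pr_x /forall_inP regC]] | noBad] := boolP
   [exists x, [&& x \in G, prime #[x] & [forall w in ('C_G[x])^#, 'C_F[w] == 1]]].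
  by apply: (Parker_cent_semiregular Gx pr_x) => w /regC/eqP.
have [z Zz ntz] := trivgPn _ ntZ.
apply/Or33/(near8 (ZtoG Zz ntz)) => v Gv.
have [u [Gu vu cvu pr_u]] := exists_commuting_prime Gv.
have [ntu Gu1] := setD1P Gu.
have : [exists w in ('C_G[u])^#, 'C_F[w] != 1].
  rewrite -negb_forall_in; apply: contra noBad => regu.
  by apply/existsP; exists u; rewrite Gu1 pr_u.
case/exists_inP=> w /setD1P[ntw /setIP[Gw /cent1P cwu]] fixw.
exists u; split=> //.
have Gw1 : w \in G^# by apply/setD1P.
by exists w; split=> //; apply: near_fixpoint.
Qed.

End Parker.

(** * Complements in Frobenius and 2-Frobenius groups *)

Section FrobeniusPieces.
Variable gT : finGroupType.
Implicit Types (x y z g : gT) (X : {set gT}) (B G H K L M N : {group gT}).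

Lemma near_sub (D E : {set gT}) n x y : D \subset E -> near D n x y -> near E n x y.
Proof.
move=> sDE; elim: n x => //= n IHn x [z [/setD1P[ntz Dz] cxz /IHn zy]].
by exists z; split=> //; apply/setD1P; rewrite (subsetP sDE).
Qed.

Lemma near_closed G X n x y :
    {in X, forall u v, u != 1 -> v \in G^# -> commute u v -> v \in X} ->
  x \in X -> x != 1 -> near G n x y -> y \in X.
Proof.
move=> clX; elim: n x => [|n IHn] x Xx ntx /=; first by move<-.
case=> z [Gz cxz zy]; have [ntz _] := setD1P Gz.
exact: IHn (clX x Xx z ntx Gz cxz) ntz zy.
Qed.

Lemma frob_complementsP G X :
  reflect (exists2 H : {group gT}, [Frobenius G with complement H] & X = H)
          (X \in frob_complements G).
Proof.
apply: (iffP imsetP) => [[H] | [H frobH ->]].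
  by rewrite inE; exists H.
by exists H; rewrite ?inE.
Qed.

Lemma Frobenius_ker_nil G K L :
  solvable G -> [Frobenius G = K ><| L] -> nilpotent K.
Proof.
move=> solG frobG; have [defG ntK ntL _ _] := Frobenius_context frobG.
have [/andP[sKG _] sLG _ nKL _] := sdprod_context defG.
have [y [Ly nty pr_y]] : exists y, [/\ y \in L, y != 1 & prime #[y]].
  have [y0 Ly0 nty0] := trivgPn _ ntL.
  have [y [y0y nty pr_y]] := exists_prime_cycle nty0.
  by exists y; rewrite (subsetP _ y y0y) ?cycle_subG.
have syL : <[y]> \subset L by rewrite cycle_subG.
apply: (prime_fixpoint_free_nil (solvableS sKG solG) (subset_trans syL nKL) pr_y).
by rewrite cent_cycle; apply: (Frobenius_reg_ker frobG); apply/setD1P.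
Qed.

(** If [#|H|] is odd, prime-order powers of [x] and [y] commute. If it is even, the unique
    involution of [H] is central, and the path is padded by repeating [y]. *)
Lemma Frobenius_compl_near G H x y :
    solvable G -> [Frobenius G with complement H] -> x \in H^# -> y \in H^# ->
  near H 3 x y.
Proof.
move=> solG frobH Hx Hy; have [K frobG] := Frobenius_kernel_exists frobH.
have [defG ntK _ _ _] := Frobenius_context frobG.
have [/andP[sKG _] sHG _ nKH _] := sdprod_context defG.
have regH := Frobenius_reg_ker frobG.
have solK := solvableS sKG solG; have solH := solvableS sHG solG.
have [[ntx Hx1] [nty Hy1]] := (setD1P Hx, setD1P Hy).
have [oddH | ] := boolP (odd #|H|).
  have [u [Hu xu cxu pr_u]] := exists_commuting_prime Hx.
  have [v [Hv yv cyv pr_v]] := exists_commuting_prime Hy.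
  have [[_ Hu1] [_ Hv1]] := (setD1P Hu, setD1P Hv).
  exists u; split=> //; exists v; split=> //; last by exists y.
  exact: (odd_semiregular_prime_commute ntK solK solH nKH regH oddH).
rewrite -dvdn2 => /Cauchy[] // t Ht ot.
have ctH h : h \in H -> commute h t.
  move=> Hh; apply/commute_sym/commgP/conjg_fixP.
  apply: (semiregular_involution_uniq ntK nKH regH) => //; last by rewrite orderJ.
  by rewrite memJ_norm ?(subsetP (normG H)).
have H1t : t \in H^# by apply/setD1P; rewrite -order_gt1 ot.
exists t; split=> //; first exact: ctH.
exists y; split=> //; first exact/commute_sym/ctH.
by exists y.
Qed.

Lemma Frobenius_compl_cent1 G H x :
  [Frobenius G with complement H] -> x \in H^# -> 'C_G[x] \subset H.
Proof. by case/andP=> _ /cent1_normedTI; apply. Qed.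

Lemma Frobenius_compl_sub G H :
  [Frobenius G with complement H] -> H \subset G.
Proof.
by case/andP=> _ /normedTI_memJ_P[_ sHG _].
Qed.

Lemma Frobenius_compl_norm G H :
  [Frobenius G with complement H] -> 'N_G(H) = H.
Proof.
case/andP=> _ /and3P[_ _ /eqP defN]; apply/eqP; rewrite eqEsubset.
rewrite -{2}defN setIS ?normD1 //= subsetI normG.
by rewrite -{1}defN subsetIl.
Qed.

(* Both complements are closed under commuting and connected, so a common
   nontrivial element makes them equal. *)
Lemma Frobenius_compl_eq G H1 H2 x :
    solvable G -> [Frobenius G with complement H1] ->
    [Frobenius G with complement H2] -> x != 1 -> x \in H1 -> x \in H2 ->
  H1 :=: H2.
Proof.
move=> solG; suff sub H3 H4 : [Frobenius G with complement H3] ->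
    [Frobenius G with complement H4] -> x != 1 -> x \in H3 -> x \in H4 -> H3 \subset H4.
  by move=> frob1 frob2 ntx H1x H2x; apply/eqP; rewrite eqEsubset !sub.
move=> frob3 frob4 ntx H3x H4x; apply/subsetP=> y H3y.
have [-> // | nty] := eqVneq y 1.
have [H3x1 H3y1] : x \in H3^# /\ y \in H3^# by split; apply/setD1P.
have := near_sub (Frobenius_compl_sub frob3) (Frobenius_compl_near solG frob3 H3x1 H3y1).
apply: near_closed => // u H4u v ntu /setD1P[ntv Gv] cuv.
have H4u1 : u \in H4^# by apply/setD1P.
apply: (subsetP (Frobenius_compl_cent1 frob4 H4u1)).
by rewrite inE Gv; apply/cent1P.
Qed.

(** [H] is not assumed to be a complement of [K]. A common nontrivial element puts ['Z(K)], then all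
    of [K], into [H], since [H] is closed under commuting. As [K] is normal, each conjugate of [z]
    stays in [H], and the TI property gives the contradiction [H = G]. *)
Lemma Frobenius_ker_compl_TI G K L H :
    solvable G -> [Frobenius G = K ><| L] -> [Frobenius G with complement H] ->
  K :&: H = 1.
Proof.
move=> solG frobG frobH; have [defG ntK _ _ _] := Frobenius_context frobG.
have [/andP[sKG nKG] _ _ _ _] := sdprod_context defG.
have ntZ : 'Z(K) != 1 by rewrite center_nil_eq1 ?(Frobenius_ker_nil solG frobG).
have [z /centerP[Kz cKz] ntz] := trivgPn _ ntZ.
apply/trivgP/subsetP=> k /setIP[Kk Hk]; apply/set1P.
apply: contraTeq isT => ntk.
have in_compl u v : u \in H -> u != 1 -> v \in K -> commute u v -> v \in H.
  move=> Hu ntu Kv cuv; have H1u : u \in H^# by apply/setD1P.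
  apply: (subsetP (Frobenius_compl_cent1 frobH H1u)).
  by rewrite inE (subsetP sKG) //; apply/cent1P.
have Hz : z \in H by apply: (in_compl k) => //; apply/commute_sym/cKz.
have sKH : K \subset H.
  by apply/subsetP=> v Kv; apply: (in_compl z) => //; apply: cKz.
have [/eqP neqHG /normedTI_memJ_P[_ sHG tiH]] := andP frobH.
case: neqHG; apply/eqP; rewrite eqEsubset sHG; apply/subsetP=> g Gg.
have H1z : z \in H^# by apply/setD1P.
rewrite -(tiH z g H1z Gg); apply/setD1P; rewrite conjg_eq1; split=> //.
by rewrite (subsetP sKH) // memJ_norm // (subsetP nKG).
Qed.

Lemma Frobenius_ker_or_compl G K L x :
    [Frobenius G = K ><| L] -> x \in G -> x \notin K ->
  exists2 k, k \in K & x \in L :^ k.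
Proof.
move=> frobG Gx nKx; have [/eqP defG _ _] := and3P (Frobenius_partition frobG).
move: Gx; rewrite -defG => /bigcupP[X /setU1P[-> /(negP nKx) // | /imsetP[k Kk ->]]].
by rewrite conjD1g => /setD1P[_ Lkx]; exists k.
Qed.

Lemma Frobenius_complJ G H g :
  g \in 'N(G) -> [Frobenius G with complement H] -> [Frobenius G with complement H :^ g].
Proof. by move=> nGg; rewrite -{2}(normP nGg) FrobeniusJcompl. Qed.

Lemma Frobenius_compl_conj G K L H :
    solvable G -> [Frobenius G = K ><| L] -> [Frobenius G with complement H] ->
  exists2 k, k \in K & H :=: L :^ k.
Proof.
move=> solG frobG frobH.
have [defG ntK _ _ _] := Frobenius_context frobG.
have [/andP[sKG nKG] _ _ _ _] := sdprod_context defG.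
have ntH : H :!=: 1.
  by have [_ /and3P[ntH _ _]] := andP frobH; rewrite setD_eq0 subG1 in ntH.
have [x Hx ntx] := trivgPn _ ntH.
have nKx : x \notin K.
  apply: contra ntx => Kx; rewrite -in_set1.
  rewrite -[[set 1]](Frobenius_ker_compl_TI solG frobG frobH).
  by rewrite inE Kx.
have Gx := subsetP (Frobenius_compl_sub frobH) x Hx.
have [k Kk Lkx] := Frobenius_ker_or_compl frobG Gx nKx.
exists k => //; apply: (Frobenius_compl_eq solG frobH _ ntx Hx Lkx).
apply: Frobenius_complJ (FrobeniusWcompl frobG).
by rewrite (subsetP (normG G)) // (subsetP sKG).
Qed.

(** An undefined semidirect product is the empty set, whereas [L * M] contains 1. *)
Lemma sdprod_mul_norm L M : L ><| M = L * M -> M \subset 'N(L).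
Proof.
have ntLM : set0 <> L * M.
  move=> LM0; have := group1 M; rewrite -(mul1g M).
  by move/(subsetP (mulSg M (sub1G L))); rewrite -LM0 inE.
rewrite /sdprod; case: ifP => // _; rewrite /partial_product.
case: eqP => [-> _ | _]; first by rewrite norm1 subsetT.
case: eqP => [-> _ | _]; first exact: sub1G.
by rewrite !groupP /=; case: ifP.
Qed.

(** * 2-Frobenius groups and their lower Frobenius subgroup *)

Section TwoFrobenius.
Variables G K L M : {group gT}.
Hypotheses (solG : solvable G) (decG : two_Frobenius_decomp G K L M).
Let B := (K <*> L)%G.

Let nKG : K <| G. Proof. by case: decG. Qed.
Let frobLM : [Frobenius L <*> M = L ><| M].
Proof.
case: decG => _ _ _ frob _; have [/eqP/sdprod_mul_norm nLM _] := andP frob.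
by rewrite norm_joinEr.
Qed.
Let defB : K * L = B.
Proof.
case: decG => _ _ frob _ _; have [/eqP/sdprod_mul_norm nKL _] := andP frob.
by rewrite /= norm_joinEr.
Qed.
Lemma two_Frobenius_lower : [Frobenius B = K ><| L].
Proof. by rewrite -defB; case: decG. Qed.
Let frobB := two_Frobenius_lower.
Let nBG : B <| G. Proof. by rewrite -defB; case: decG. Qed.
Let defG : K * (L <*> M) = G.
Proof.
case: decG => _ _ _ frob <-; have [/eqP/sdprod_mul_norm nLM _] := andP frob.
by rewrite norm_joinEr // mulgA.
Qed.
Let solB : solvable B. Proof. exact: solvableS (normal_sub nBG) solG. Qed.

(** By conjugacy of complements, take [H = L]. If [g] centralizes [y] in [L^#], then [L] and
    [L :^ g] are complements sharing [y], so [g] normalizes [L]. This puts [g] in [L <*> M], whose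
    kernel [L] contains the centralizer of [y]. *)
Lemma two_Frobenius_compl_cent1 H x :
  [Frobenius B with complement H] -> x \in H^# -> 'C_G[x] \subset H.
Proof.
have frobL := FrobeniusWcompl frobB.
have [sdB _ _ _ _] := Frobenius_context frobB.
have [_ _ _ nKL tiKL] := sdprod_context sdB.
have [sdLM _ _ _ _] := Frobenius_context frobLM.
have [/andP[_ nLLM] _ _ _ _] := sdprod_context sdLM.
have sNL : 'N_G(L) \subset L <*> M.
  apply/subsetP=> g /setIP[]; rewrite -defG => /imset2P[k n Kk LMn ->] nLkn.
  suff /set1P-> : k \in [1] by rewrite mul1g.
  rewrite -tiKL inE Kk -(Frobenius_compl_norm frobL) inE.
  rewrite (subsetP (joing_subl K L)) //=.
  by rewrite -(groupMr _ (subsetP nLLM n LMn)).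
have cL y : y \in L^# -> 'C_G[y] \subset L.
  move=> L1y; have [nty Ly] := setD1P L1y; apply/subsetP=> g /setIP[Gg cyg].
  have nLg : g \in 'N(L).
    apply/normP; apply: (@Frobenius_compl_eq B (L :^ g)%G L y solB) => //.
      by apply: Frobenius_complJ frobL; rewrite (subsetP (normal_norm nBG)).
    have /conjg_fixP <- : [~ y, g] == 1 by apply/commgP/commute_sym/cent1P.
    by rewrite memJ_conjg.
  have LMg : g \in L <*> M by rewrite (subsetP sNL) // inE Gg.
  apply: (subsetP (Frobenius_cent1_ker frobLM L1y)).
  by rewrite inE LMg.
move=> frobH /setD1P[ntx Hx].
have [k Kk defH] := Frobenius_compl_conj solB frobB frobH.
have Gk : k \in G := subsetP (normal_sub nKG) k Kk.
rewrite defH -{1}(normsP (normG G) k Gk) -{1}(conjgKV k x) cent1J -conjIg conjSg.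
apply: cL; apply/setD1P; rewrite conjg_eq1; split=> //.
by rewrite -mem_conjg -defH.
Qed.

(** It suffices that a prime-order power [u] of [g] has a fixed point in [K]. Outside [K], [u] is
    also outside [B]. If [#[u]] is coprime to [#|K|], a conjugate [n] of [u] lies in [L <*> M] but
    not in [L], and the Frobenius group [L <*> <[n]>] acts on ['Z(K)]. Otherwise [u] acts on the
    nontrivial [#[u]]-part of [K]. *)
Lemma two_Frobenius_near g z :
    g \in G^# -> g \notin cover (frob_complements B) -> z \in 'Z(K) -> z != 1 ->
  near G 3 g z.
Proof.
move=> G1g nFg Zz ntz; have [ntg Gg] := setD1P G1g.
have [sKG nKGn] := andP nKG.
have /centerP[Kz cKz] := Zz.
have G1z : z \in G^# by apply/setD1P; rewrite (subsetP sKG).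
have [u [G1u gu cgu pr_u]] := exists_commuting_prime G1g.
have [ntu Gu] := setD1P G1u.
suff /trivgPn[w /setIP[Kw /cent1P cuw] ntw] : 'C_K[u] != 1.
  exists u; split=> //; exists w; split=> //.
    by apply/setD1P; rewrite (subsetP sKG).
  by exists z; split=> //; apply/commute_sym/cKz.
have [Ku | nKu] := boolP (u \in K).
  by apply/trivgPn; exists u => //; rewrite inE Ku cent1id.
have nBu : u \notin B.
  apply: contra nFg => Bu; have [k Kk Lku] := Frobenius_ker_or_compl frobB Bu nKu.
  have frobLk : [Frobenius B with complement L :^ k].
    apply: Frobenius_complJ (FrobeniusWcompl frobB).
    by rewrite (subsetP (normG B)) // (subsetP (joing_subl K L)).
  apply/bigcupP; exists (L :^ k).
    by apply/frob_complementsP; exists (L :^ k)%G.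
  have L1u : u \in (L :^ k)%G^# by apply/setD1P.
  apply: (subsetP (two_Frobenius_compl_cent1 frobLk L1u)).
  by rewrite inE Gg; apply/cent1P.
have [sdB ntK ntL _ _] := Frobenius_context frobB.
have nilK : nilpotent K := Frobenius_ker_nil solB frobB.
have [_ _ _ nKL tiKL] := sdprod_context sdB.
have [sdLM _ _ _ _] := Frobenius_context frobLM.
have [/andP[sLLM nLLM] _ _ _ _] := sdprod_context sdLM.
have sLMG : L <*> M \subset G by rewrite -defG mulG_subr.
have [coKu | ] := boolP (coprime #|K| #[u]).
  have [f Kf LMuf] := mulg_coprime_conj defG Gu pr_u coKu.
  set n := u ^ f in LMuf.
  have nLn : n \notin L.
    apply: contra nBu => Ln; rewrite -(memJ_norm u (_ : f \in 'N(B))).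
      by rewrite (subsetP (joing_subr K L)).
    by rewrite (subsetP (normG B)) // (subsetP (joing_subl K L)).
  have cLn : 'C_L[n] = 1.
    apply/trivgP/subsetP=> c /setIP[Lc ccn]; apply/set1P.
    apply: contraNeq nLn => ntc; have L1c : c \in L^# by apply/setD1P.
    apply: (subsetP (Frobenius_cent1_ker frobLM L1c)).
    by rewrite inE LMuf cent1C.
  have pr_n : prime #|<[n]>| by rewrite -orderE orderJ.
  have nLn' : <[n]> \subset 'N(L) by rewrite cycle_subG (subsetP nLLM).
  have frobLn : [Frobenius L <*> <[n]> = L ><| <[n]>].
    apply/prime_FrobeniusP => //; rewrite cent_cycle; split=> //.
    by rewrite sdprodEY // setIC prime_TIg // cycle_subG.
  have nZG : G \subset 'N('Z(K)) := char_norm_trans (center_char K) nKGn.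
  have sZK := center_sub K.
  have regL := semiregularS sZK (subxx L) (Frobenius_reg_ker frobB).
  have := abelian_Frobenius_cent frobLn (center_abelian K) _ _ _ _.
  rewrite join_subG cycle_subG (subsetP nZG) ?(subsetP sLMG) //.
  rewrite (subset_trans sLLM (subset_trans sLMG nZG)) center_nil_eq1 // ntK.
  rewrite (coprimeSg sZK (Frobenius_coprime frobB)) (cent_semiregular regL) //.
  move=> /(_ isT isT isT erefl); rewrite cent_cycle.
  apply: contra => /eqP cKu; rewrite -subG1.
  by rewrite -(conjs1g f) -cKu conjIg -cent1J (normsP (normG K) f Kf) setSI.
rewrite coprime_sym prime_coprime // negbK => u_dv_K.
have ntO : 'O_#[u](K) != 1.
  rewrite -cardG_gt1 (card_Hall (nilpotent_pcore_Hall #[u] nilK)).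
  by rewrite p_part_gt1 mem_primes pr_u cardG_gt0.
have := @pgroup_cent_neq1 _ #[u] <[u]>%G 'O_#[u](K)%G _ (pcore_pgroup _ _) _ ntO.
rewrite /pgroup -orderE pnat_id // cycle_subG.
rewrite (subsetP (char_norm_trans (pcore_char _ K) nKGn)) //= cent_cycle => /(_ isT isT).
by apply: contra => /eqP cKu; rewrite -subG1 -cKu setSI // pcore_sub.
Qed.

(** [K] is the Fitting subgroup of [G], and [B / K] is a normal Hall subgroup of [G / K]. *)
Lemma two_Frobenius_lower_char : B \char G.
Proof.
have [sdB ntK ntL _ _] := Frobenius_context frobB.
have nilK : nilpotent K := Frobenius_ker_nil solB frobB.
have [nsKB _ _ nKL tiKL] := sdprod_context sdB.
have [sdLM _ _ _ _] := Frobenius_context frobLM.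
have [nsLLM _ _ _ _] := sdprod_context sdLM.
have [[sKG nKGn] [sLLM nLLM]] := (andP nKG, andP nsLLM).
have nKLM : L <*> M \subset 'N(K) by rewrite (subset_trans _ nKGn) // -defG mulG_subr.
pose F := 'F(G)%G; have sKF : K \subset F by apply: Fitting_max.
have tiFL : F :&: L = 1.
  have sFL : F :&: L \subset L := subsetIr _ _.
  have cKL0 : F :&: L \subset 'C(K).
    apply: (sub_nilpotent_cent2 (Fitting_nil G)) => //; first exact: subsetIl.
    exact: coprimegS sFL (Frobenius_coprime frobB).
  apply/trivgP/subsetP=> l FLl; apply/set1P; apply: contraNeq ntK => ntl.
  have L1l : l \in L^# by apply/setD1P; rewrite (subsetP sFL).
  rewrite -subG1 -(Frobenius_reg_ker frobB L1l) subsetI subxx /=.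
  by rewrite sub_cent1 (subsetP cKL0).
have defF : F :=: K.
  apply/eqP; rewrite eqEsubset sKF andbT; apply/subsetP=> g Fg.
  have := subsetP (Fitting_sub G) g Fg; rewrite -defG.
  case/imset2P=> k n Kk LMn def_g.
  have Fn : n \in F by rewrite -(groupMl _ (subsetP sKF k Kk)) -def_g.
  suff Ln : n \in L.
    have : n \in F :&: L by rewrite inE Fn.
    by rewrite tiFL => /set1P n1; rewrite def_g n1 mulg1.
  have [l Ll ntl] := trivgPn _ ntL.
  have L1l : l \in L^# by apply/setD1P.
  (* The commutator of [l] and [n] lies in both [F] and [L], hence is trivial. *)
  apply: (subsetP (Frobenius_cent1_ker frobLM L1l)); rewrite inE LMn.
  apply/cent1P/commgP; rewrite -in_set1 -[[set 1]]tiFL inE; apply/andP; split.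
    rewrite commgEl groupMl ?groupV // memJ_norm //.
    rewrite (subsetP (normal_norm (Fitting_normal G))) // -defG.
    by rewrite (subsetP (mulG_subr K _)) // (subsetP sLLM).
  by rewrite commgEr groupMr // memJ_norm ?groupV // (subsetP nLLM).
have charK : K \char G by rewrite -defF Fitting_char.
apply: (char_from_quotient nsKB charK).
have pHallL := quotient_pHall (subset_trans sLLM nKLM) (Hall_pi (Frobenius_ker_Hall frobLM)).
rewrite -defB -{1}defG !quotientMidl.
have nsLLMK : L / K <| (L <*> M) / K := quotient_normal K nsLLM.
by rewrite -(normal_Hall_pcore pHallL nsLLMK) pcore_char.
Qed.

End TwoFrobenius.
End FrobeniusPieces.

(** * Components of the orbit graph *)

Section OrbitGraph.
Variables (aT gT : finGroupType) (A : {group aT}) (G : {group gT}).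
Variable to : groupAction A G.
Implicit Types (x y z u v : gT) (a b : aT) (O : {set gT}).
Local Notation V := (cg_vertices to).
Local Notation E := (cg_edge to).
Local Notation orb := (orbit to A).

Lemma act_D1 a x : a \in A -> (to x a \in G^#) = (x \in G^#).
Proof.
move=> Aa; rewrite !inE gact_stable //; congr (~~ _ && _).
by rewrite -{1}(gact1 to Aa) (inj_eq (act_inj to a)).
Qed.

Lemma cg_verticesP O : reflect (exists2 x, x \in G^# & O = orb x) (O \in V).
Proof. exact: imsetP. Qed.

Lemma orb_vertex x : x \in G^# -> orb x \in V.
Proof. exact: imset_f. Qed.

Lemma commute_cg_edge x y : x \in G^# -> y \in G^# -> commute x y ->
  orb x = orb y \/ E (orb x) (orb y).
Proof.
move=> Gx Gy cxy; have [-> | neq] := eqVneq (orb x) (orb y); first by left.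
right; apply/and4P; split; rewrite ?orb_vertex //.
apply/exists_inP; exists x; first exact: orbit_refl.
by apply/exists_inP; exists y; [apply: orbit_refl | apply/eqP].
Qed.

(** Steps inside a single orbit are dropped, so the length can only decrease. *)
Lemma near_path n x y : x \in G^# -> near G n x y ->
  exists p, [/\ path E (orb x) p, last (orb x) p = orb y & size p <= n].
Proof.
elim: n x => [|n IHn] x Gx /=; first by move->; exists [::].
case=> z [Gz cxz /(IHn z Gz)[p [Ep lastp szp]]].
have [eqxz | Exz] := commute_cg_edge Gx Gz cxz.
  by exists p; rewrite eqxz; split=> //; apply: leqW.
by exists (orb z :: p); rewrite /= Exz.
Qed.

Lemma near_connect n x y : x \in G^# -> near G n x y -> connect E (orb x) (orb y).
Proof.
by move=> Gx /(near_path Gx)[p [Ep lastp _]]; apply/connectP; exists p.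
Qed.

Lemma near_diam n : {in G^# &, forall x y, near G n x y} -> diam_le V E n.
Proof.
move=> nearG _ _ /cg_verticesP[x Gx ->] /cg_verticesP[y Gy ->].
exact: near_path (nearG x y Gx Gy).
Qed.

Lemma near_not_disconnected n :
  {in G^# &, forall x y, near G n x y} -> ~~ disconnected_graph V E.
Proof.
move=> nearG; rewrite /disconnected_graph -leqNgt; apply/card_le1_eqP.
move=> _ _ /imsetP[_ /cg_verticesP[x Gx ->] ->] /imsetP[_ /cg_verticesP[y Gy ->] ->].
have compT z : z \in G^# -> component V E (orb z) = V.
  move=> Gz; apply/setP=> O; rewrite inE; apply: andb_idr => /cg_verticesP[t Gt ->].
  exact: near_connect (nearG z t Gz Gt).
by rewrite !compT.
Qed.

(** * Counting components from a partition into connected pieces closed under commuting *)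

Section Pieces.
Variable P : {set {set gT}}.
Hypothesis coverP : forall x, x \in G^# -> exists2 X, X \in P & x \in X.
Hypothesis tiP : forall X Y x,
  X \in P -> Y \in P -> x \in G^# -> x \in X -> x \in Y -> X = Y.
Hypothesis actP : forall X a, X \in P -> a \in A -> (to^*)%act X a \in P.
Hypothesis ntP : forall X, X \in P -> exists2 x, x \in X & x \in G^#.
Hypothesis closedP : forall X x y,
  X \in P -> x \in X -> x \in G^# -> y \in G^# -> commute x y -> y \in X.
Hypothesis connP : forall X x y,
  X \in P -> x \in X -> y \in X -> x \in G^# -> y \in G^# -> exists n, near G n x y.

Let orbP := orbit (to^*)%act A.
Let comp_of (S : {set {set gT}}) := [set orb x | x in G^# & x \in cover S].

Lemma comp_ofP X O : X \in P -> reflect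
  (exists a x, [/\ a \in A, x \in G^#, x \in (to^*)%act X a & O = orb x])
  (O \in comp_of (orbP X)).
Proof.
move=> PX; apply: (iffP imsetP) => [[x] | [a [x [Aa Gx Xax ->]]]].
  rewrite inE => /andP[Gx /bigcupP[Y /orbitP[a Aa <-] Yx]] ->.
  by exists a, x.
exists x => //; rewrite inE Gx; apply/bigcupP.
by exists ((to^*)%act X a) => //; apply: mem_orbit.
Qed.

(** Connectedness of [X] gives one inclusion. For the other, follow a path: every translate of [X]
    is again a piece closed under commuting, so no edge leaves [comp_of (orbP X)]. *)
Lemma component_comp_of X x : X \in P -> x \in X -> x \in G^# ->
  component V E (orb x) = comp_of (orbP X).
Proof.
move=> PX Xx Gx; apply/setP=> O; rewrite inE; apply/andP/idP => [[VO] | ]; last first.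
  case/(comp_ofP _ PX)=> a [u [Aa Gu Xau ->]]; rewrite orb_vertex //; split=> //.
  case/imsetP: Xau Gu => u0 Xu0 ->; rewrite act_D1 // => Gu0.
  have -> : orb (to u0 a) = orb u0.
    by apply/orbit_in_eqP => //; apply: mem_orbit.
  have [n xu0] := connP PX Xx Xu0 Gx Gu0.
  exact: near_connect xu0.
case/connectP=> p Ep def_O; rewrite {O}def_O in VO *.
have: orb x \in comp_of (orbP X).
  apply/comp_ofP => //; exists 1, x; split=> //.
  by rewrite act1.
elim: p (orb x) Ep {VO} => //= O2 p IHp O1 /andP[E12 Ep] XO1; apply: IHp Ep _.
case/and4P: E12 => VO1 VO2 _ /exists_inP[u O1u /exists_inP[v O2v /eqP cuv]].
have [a [t [Aa Gt Xat defO1]]] := comp_ofP _ PX XO1.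
move: O1u; rewrite defO1 => /orbitP[b Ab def_u].
have [s Gs defO2] := cg_verticesP _ VO2.
move: O2v; rewrite defO2 => /orbitP[c Ac def_v].
have Gv : v \in G^# by rewrite -def_v act_D1.
have Gu : u \in G^# by rewrite -def_u act_D1.
apply/comp_ofP => //; exists (a * b), v; split=> //; first exact: groupM.
  have PXab : (to^*)%act X (a * b) \in P by rewrite actP ?groupM.
  apply: (closedP PXab _ Gu Gv cuv).
  by rewrite actMin // -def_u; apply: mem_setact.
by rewrite -def_v; apply/esym/orbit_in_eqP => //; apply: mem_orbit.
Qed.

Lemma n_components_pieces : n_components V E = #|[set orbP X | X in P]|.
Proof.
rewrite /n_components.
have -> : [set component V E O | O in V] = comp_of @: [set orbP X | X in P].
  rewrite -[RHS]imset_comp; apply/setP=> S; apply/imsetP/imsetP.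
    case=> _ /cg_verticesP[x Gx ->] ->; have [X PX Xx] := coverP Gx.
    by exists X => //; apply: component_comp_of.
  case=> X PX ->; have [x Xx Gx] := ntP PX.
  by exists (orb x); [apply: orb_vertex | rewrite (component_comp_of PX Xx Gx)].
apply: card_in_imset => _ _ /imsetP[X PX ->] /imsetP[Y PY ->] eqXY.
have [x Xx Gx] := ntP PX.
have : orb x \in comp_of (orbP Y).
  rewrite -eqXY; apply/comp_ofP => //; exists 1, x; split=> //.
  by rewrite act1.
case/(comp_ofP _ PY)=> a [u [Aa Gu Yau /orbit_in_eqP]].
move/(_ (subxx A))/orbitP=> [b Ab def_x].
have PYab : (to^*)%act Y (a * b) \in P by rewrite actP ?groupM.
have -> : X = (to^*)%act Y (a * b).
  apply: (tiP PX PYab Gx Xx); rewrite actMin // -def_x.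
  exact: mem_setact.
by apply/orbit_in_eqP => //; apply: mem_orbit; apply: groupM.
Qed.

End Pieces.

(** * The pieces of a Frobenius or 2-Frobenius group *)

Section FrobeniusSection.
Variables B K L : {group gT}.
Hypotheses (solG : solvable G) (charB : B \char G) (frobB : [Frobenius B = K ><| L]).
Hypothesis centB : forall (H : {group gT}) x,
  [Frobenius B with complement H] -> x \in H^# -> 'C_G[x] \subset H.
Hypothesis nearB : forall g z, g \in G^# -> g \notin cover (frob_complements B) ->
  z \in 'Z(K) -> z != 1 -> near G 3 g z.

Let sBG : B \subset G := char_sub charB.
Let solB : solvable B := solvableS sBG solG.
Let fc := frob_complements B.
(** The difference is taken in [G], not in [B], so all elements outside [B] belong to this piece. *)
Let M := G :\: cover fc.

Lemma frob_complements_act H a : H \in fc -> a \in A -> (to^*)%act H a \in fc.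
Proof.
case/frob_complementsP=> {}H frobH -> Aa; apply/frob_complementsP.
have sHG := subset_trans (Frobenius_compl_sub frobH) sBG.
exists (actm to a @* H)%G; last by rewrite /= morphim_actm.
have /charP[_ charmB] := charB.
rewrite -(charmB _ (injm_actm to a) (im_actm to a)).
exact: injm_Frobenius_compl sBG (injm_actm to a) frobH.
Qed.

Lemma outside_complements_act a : a \in A -> (to^*)%act M a = M.
Proof.
move=> Aa; apply/eqP; rewrite eqEcard card_setact leqnn andbT.
apply/subsetP=> _ /imsetP[x /setDP[Gx nFx] ->]; rewrite inE gact_stable // Gx andbT.
apply: contra nFx => /bigcupP[H fcH Hxa].
apply/bigcupP; exists ((to^*)%act H a^-1); first by rewrite frob_complements_act ?groupV.
by rewrite -[x](actKin to Aa); apply: mem_setact.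
Qed.

(** The pieces are the complements and [M]. Since [A] fixes [M], it accounts for the one extra
    component; its orbit is a new one because complements contain 1 and [M] does not. *)
Lemma n_components_Frobenius_section :
  n_components V E = (n_complement_orbits to B).+1.
Proof.
have [defB ntK ntL _ _] := Frobenius_context frobB.
have [/andP[sKB _] _ _ _ _] := sdprod_context defB.
have ntZ : 'Z(K) != 1 by rewrite center_nil_eq1 ?(Frobenius_ker_nil solB frobB).
have [z Zz ntz] := trivgPn _ ntZ; have /centerP[Kz _] := Zz.
have G1z : z \in G^# by apply/setD1P; rewrite (subsetP sBG) // (subsetP sKB).
have fcP H x : H \in fc -> x \in H -> x \in G^# ->
    exists H' : {group gT}, [/\ [Frobenius B with complement H'], H = H' & x \in H'^#].
  case/frob_complementsP=> H' frobH' -> H'x /setD1P[ntx _].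
  by exists H'; split=> //; apply/setD1P.
have Mz : z \in M.
  rewrite inE; have /setD1P[_ ->] := G1z; rewrite andbT.
  apply: contra ntz => /bigcupP[_ /frob_complementsP[H frobH ->] Hz].
  by rewrite -in_set1 -[[set 1]](Frobenius_ker_compl_TI solB frobB frobH) inE Kz.
have fc1 H : H \in fc -> 1 \in H by case/frob_complementsP=> {}H _ ->; apply: group1.
have M1 : 1 \notin M.
  rewrite inE negb_and negbK; apply/orP; left.
  apply/bigcupP; exists (gval L) => //; apply/frob_complementsP.
  by exists L => //; apply: FrobeniusWcompl frobB.
have defN : n_components V E = #|[set orbit (to^*)%act A X | X in M |: fc]|.
  apply: n_components_pieces.
  - move=> x /setD1P[_ Gx]; have [/bigcupP[H fcH Hx] | nFx] := boolP (x \in cover fc).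
      by exists H; rewrite // setU1r.
    by exists M; rewrite ?setU11 // inE nFx.
  - have tiM X x : X \in fc -> x \in X -> x \in M -> False.
      by move=> fcX Xx /setDP[_ /bigcupP[]]; exists X.
    move=> X Y x /setU1P[-> | fcX] /setU1P[-> | fcY] G1x Xx Yx //.
    + by case: (tiM Y x).
    + by case: (tiM X x).
    have [H1 [frob1 -> /setD1P[ntx H1x]]] := fcP X x fcX Xx G1x.
    have [H2 [frob2 -> /setD1P[_ H2x]]] := fcP Y x fcY Yx G1x.
    exact: Frobenius_compl_eq solB frob1 frob2 ntx H1x H2x.
  - move=> X a /setU1P[-> | fcX] Aa; first by rewrite outside_complements_act ?setU11.
    by rewrite setU1r ?frob_complements_act.
  - move=> X /setU1P[-> | fcX]; first by exists z.
    have /frob_complementsP[H frobH ->] := fcX.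
    have [_ /normedTI_memJ_P[/set0Pn[x H1x] _ _]] := andP frobH.
    have [ntx Hx] := setD1P H1x; exists x => //; apply/setD1P; split=> //.
    by rewrite (subsetP sBG) // (subsetP (Frobenius_compl_sub frobH)).
  - have closed_fc X x y : X \in fc -> x \in X -> x \in G^# -> y \in G^# ->
        commute x y -> y \in X.
      move=> fcX Xx G1x /setD1P[_ Gy] cxy.
      have [H [frobH -> H1x]] := fcP X x fcX Xx G1x.
      apply: (subsetP (centB frobH H1x)).
      by rewrite inE Gy; apply/cent1P.
    move=> X x y /setU1P[-> | fcX] Xx G1x G1y cxy; last exact: closed_fc cxy.
    have [_ Gy] := setD1P G1y; rewrite inE Gy andbT.
    have /setDP[_] := Xx; apply: contra => /bigcupP[Y fcY Yy].
    by apply/bigcupP; exists Y => //; apply: closed_fc G1y G1x _.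
  move=> X x y PX Xx Xy Gx Gy; case/setU1P: PX => [defX | fcX].
    have nearM u : u \in X -> u \in G^# -> near G 3 u z.
      by rewrite defX => /setDP[_ nFu] Gu; apply: nearB.
    exists (3 + 3)%N; apply: near_trans (nearM x Xx Gx) _.
    exact/(near_sym Gy)/nearM.
  have [H [frobH defX H1x]] := fcP X x fcX Xx Gx.
  have H1y : y \in H^# by move: Gy => /setD1P[nty _]; apply/setD1P; rewrite -defX.
  exists 3; apply: near_sub (subset_trans (Frobenius_compl_sub frobH) sBG) _.
  exact: Frobenius_compl_near solB frobH H1x H1y.
rewrite defN imsetU1 cardsU1.
suff -> : orbit (to^*)%act A M \notin [set orbit (to^*)%act A X | X in fc] by [].
apply: contra M1 => /imsetP[H fcH eqMH].
have /orbitP[a Aa <-] : M \in orbit (to^*)%act A H by rewrite -eqMH orbit_refl.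
by apply: fc1; apply: frob_complements_act.
Qed.

End FrobeniusSection.
End OrbitGraph.

(** * Component counts and the diameter bound *)

Section Main.
Variables (aT gT : finGroupType) (A : {group aT}) (G : {group gT}).
Variable to : groupAction A G.
Hypothesis solG : solvable G.
Local Notation V := (cg_vertices to).
Local Notation E := (cg_edge to).

Lemma n_components_Frobenius :
  [Frobenius G] -> n_components V E = (n_complement_orbits to G).+1.
Proof.
case/existsP=> L /Frobenius_kernel_exists[K frobG].
apply: (n_components_Frobenius_section to solG (char_refl G) frobG).
  by move=> H x; apply: Frobenius_compl_cent1.
move=> g z G1g nFg Zz ntz; have [ntg Gg] := setD1P G1g.
have [defG _ _ _ _] := Frobenius_context frobG.
have [/andP[sKG _] _ _ _ _] := sdprod_context defG.
have /centerP[Kz cKz] := Zz.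
apply: (near_le (m := 1)) => //; apply: near1.
  by apply/setD1P; rewrite (subsetP sKG).
apply/commute_sym/cKz; apply: contraR nFg => nKg.
have [k Kk Lkg] := Frobenius_ker_or_compl frobG Gg nKg.
apply/bigcupP; exists (L :^ k) => //; apply/frob_complementsP; exists (L :^ k)%G => //.
apply: Frobenius_complJ (FrobeniusWcompl frobG).
by rewrite (subsetP (normG G)) // (subsetP sKG).
Qed.

Lemma two_Frobenius_mul (K L M : {group gT}) : two_Frobenius_decomp G K L M -> K * L = K <*> L.
Proof.
case=> _ _ frob _ _; have [/eqP/sdprod_mul_norm nKL _] := andP frob.
by rewrite norm_joinEr.
Qed.

Lemma n_components_two_Frobenius (K L M : {group gT}) :
  two_Frobenius_decomp G K L M ->
  n_components V E = (n_complement_orbits to (K * L)).+1.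
Proof.
move=> decG; rewrite (two_Frobenius_mul decG).
apply: (n_components_Frobenius_section to solG (two_Frobenius_lower_char solG decG)
          (two_Frobenius_lower decG)).
  by move=> H x; apply: (two_Frobenius_compl_cent1 solG decG).
by move=> g z; apply: (two_Frobenius_near solG decG).
Qed.

Lemma n_complement_orbits_gt0 (B H : {group gT}) :
  [Frobenius B with complement H] -> 0 < n_complement_orbits to B.
Proof.
move=> frobH; apply/card_gt0P; exists (orbit (to^*)%act A H); apply: imset_f.
by apply/frob_complementsP; exists H.
Qed.

Lemma Parker_graph :
  [\/ [Frobenius G], two_Frobenius G | {in G^# &, forall u v, near G 8 u v}].
Proof.
have [G1 | ntG] := eqVneq (gval G) 1; last exact: Parker_dichotomy.
by apply: Or33 => u v; rewrite G1 setDv inE.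
Qed.

End Main.

Theorem theorem2p2 (aT gT : finGroupType) (A : {group aT}) (G : {group gT})
    (to : groupAction A G) :
  solvable G ->
  [/\ (disconnected_graph (cg_vertices to) (cg_edge to)
         <-> [Frobenius G] \/ two_Frobenius G),
      ([Frobenius G] ->
         n_components (cg_vertices to) (cg_edge to)
           = (n_complement_orbits to G).+1),
      (forall K L M : {group gT}, two_Frobenius_decomp G K L M ->
         n_components (cg_vertices to) (cg_edge to)
           = (n_complement_orbits to (K * L)).+1)
    & (~~ disconnected_graph (cg_vertices to) (cg_edge to) ->
         diam_le (cg_vertices to) (cg_edge to) 8)].
Proof.
move=> solG.
(* At least one Frobenius complement exists, so the number of components exceeds 1. *)
have disc : [Frobenius G] \/ two_Frobenius G ->
    disconnected_graph (cg_vertices to) (cg_edge to).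
  case=> [frobG | [K [L [M decG]]]]; rewrite /disconnected_graph.
    rewrite n_components_Frobenius //; have /existsP[H frobH] := frobG.
    exact: n_complement_orbits_gt0 frobH.
  rewrite (n_components_two_Frobenius to solG decG) (two_Frobenius_mul decG).
  exact: n_complement_orbits_gt0 (FrobeniusWcompl (two_Frobenius_lower decG)).
split.
- split=> // discG; case: (Parker_graph solG) => [||nearG]; [by left | by right |].
  by rewrite (negPf (near_not_disconnected to nearG)) in discG.
- exact: n_components_Frobenius.
- exact: n_components_two_Frobenius.
move=> connG; case: (Parker_graph solG) => [frobG | frob2G | nearG].
- by case/negP: connG; apply: disc; left.
- by case/negP: connG; apply: disc; right.
exact: near_diam.
Qed.
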